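(* Any special involutive commutative Hausdorff topological two-valued group $X$ is isomorphic to one of the topological two-valued groups of the form $Y_{V,U,s}$. Two topological two-valued groups $Y_{V_i,U_i,s_i}$, $i=1,2$, are isomorphic to each other if and only if $V_1\cong V_2$ as abstract groups and there exists an isomorphism of topological groups $U_1\cong U_2$ taking $s_1$ to $s_2$.
   Context: For a set $X$, $\mathrm{Sym}^2(X)$ is the set of two-element multisets $[x,y]$ of elements of $X$. A two-valued group is a set $X$ with a map $*\colon X\times X\to \mathrm{Sym}^2(X)$, an element $e\in X$ and a map $x\mapsto x^{-1}$ such that: (associativity) $x*(y*z)=(x*y)*z$ as four-element multisets, where $x*[u,v]$ is the multiset union of $x*u$ and $x*v$, and similarly for $[u,v]*z$; (strong identity) $e*x=x*e=[x,x]$; (existence and uniqueness of inverse) $e$ belongs to each of $x*x^{-1}$ and $x^{-1}*x$, and if $e$ belongs to $x*y$ or to $y*x$ then $y=x^{-1}$. It is commutative if $x*y=y*x$ for all $x,y$, and involutive if $x^{-1}=x$ for all $x$. A topological two-valued group is a topological space $X$ with a two-valued group structure such that $*\colon X\times X\to\mathrm{Sym}^2(X)$ and $x\mapsto x^{-1}$ are continuous, where $\mathrm{Sym}^2(X)$ has the quotient topology from $X\times X$. An isomorphism of topological two-valued groups is a homeomorphism $f$ such that $x*y=[z_1,z_2]$ implies $f(x)*f(y)=[f(z_1),f(z_2)]$. For an element $x$ of an involutive two-valued group there is a unique sequence $x^0=e,\ x^1=x,\ x^2,\ldots$ with $x*x^k=x^k*x=[x^{k-1},x^{k+1}]$ for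 all $k\ge1$; $\mathrm{ord}\,x$ is the least positive integer $k$ with $x^k=e$ ($\infty$ if none). An involutive commutative two-valued group is special if it contains elements $x,y$ with $\mathrm{ord}\,x>2$, $\mathrm{ord}\,y>2$ such that $x*y$ consists of two identical elements. A Boolean group is a group all of whose non-identity elements have order 2, written multiplicatively (a vector space over $\mathbb F_2$); a topological Boolean group is a topological group that is Boolean. Let $V$ be a Boolean group with the discrete topology and $\dim_{\mathbb F_2} V\ge 2$, let $U$ be a Hausdorff topological Boolean group, and let $s\in U$, $s\ne e$. Put $W=U/\langle s\rangle$ with the quotient topology and projection $\pi\colon U\to W$. Then $Y_{V,U,s}$ is the topological space $(\{e\}\times U)\sqcup\bigl((V\setminus\{e\})\times W\bigr)$ (disjoint union) with the commutative two-valued multiplication $(e,u_1)*(e,u_2)=[(e,u_1u_2),(e,u_1u_2)]$ for $u_1,u_2\in U$; $(e,u)*(v,w)=[(v,\pi(u)w),(v,\pi(u)w)]$ for $u\in U$, $v\in V\setminus\{e\}$, $w\in W$; $(v,w_1)*(v,w_2)=[(e,u),(e,su)]$, where $\{u,su\}=\pi^{-1}(w_1w_2)$, for $v\in V\setminus\{e\}$, $w_1,w_2\in W$; $(v_1,w_1)*(v_2,w_2)=[(v_1v_2,w_1w_2),(v_1v_2,w_1w_2)]$ for distinct $v_1,v_2\in V\setminus\{e\}$, $w_1,w_2\in W$. It is a special involutive commutative Hausdorff topological two-valued group. *)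

(* Defs.v *)
From HB Require Import structures.
From mathcomp Require Import all_boot all_algebra all_classical topology.

Set Implicit Arguments.
Unset Strict Implicit.
Unset Printing Implicit Defensive.

Local Open Scope classical_set_scope.
Local Open Scope quotient_scope.
Local Open Scope group_scope.

Definition swap_rel (X : choiceType) : rel (X * X) :=
  fun p q => (q == p) || (q == (p.2, p.1)).

Lemma swap_rel_equiv (X : choiceType) : equiv_class_of (@swap_rel X).
Proof.
split=> [p|[a b] [c d]|[a b] [c d] [e f]]; rewrite /swap_rel /=.
- by rewrite eqxx.
- by rewrite !xpair_eqE; apply/orP/orP => -[] /andP[/eqP-> /eqP->];
    rewrite !eqxx; auto.
- by rewrite !xpair_eqE => /orP[] /andP[/eqP-> /eqP->] /orP[]
    /andP[/eqP-> /eqP->]; rewrite !eqxx ?orbT.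
Qed.

Canonical swap_equiv (X : choiceType) := EquivRelPack (swap_rel_equiv X).

Definition Sym2 (X : choiceType) : Type :=
  quotient_topology {eq_quot swap_equiv X}.

Definition sym2 (X : choiceType) (x y : X) : Sym2 X :=
  \pi_({eq_quot swap_equiv X}) (x, y).

(* the list of the two elements, in an order that depends on the choice of
   [repr]; meaningful up to [perm_eq] *)
Definition sym2_elems (X : choiceType) (z : Sym2 X) : seq X :=
  let p := repr (z : {eq_quot swap_equiv X}) in [:: p.1; p.2].

Lemma sym2_elemsE (X : choiceType) (x y : X) :
  perm_eq (sym2_elems (sym2 x y)) [:: x; y].
Proof.
rewrite /sym2_elems /sym2; case: piP => -[a b] /eqmodP /= /orP[] /eqP[-> ->] //.
by rewrite -cat1s perm_catC.
Qed.

HB.mixin Record isTwoValuedGroup X of Choice X := {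
  tvmul : X -> X -> Sym2 X;
  tvone : X;
  tvinv : X -> X;
  tvmulA : forall x y z : X,
    perm_eq (flatten [seq sym2_elems (tvmul x t) | t <- sym2_elems (tvmul y z)])
            (flatten [seq sym2_elems (tvmul t z) | t <- sym2_elems (tvmul x y)]);
  tvmul1x : forall x : X, tvmul tvone x = sym2 x x;
  tvmulx1 : forall x : X, tvmul x tvone = sym2 x x;
  tvmulxV : forall x : X, tvone \in sym2_elems (tvmul x (tvinv x));
  tvmulVx : forall x : X, tvone \in sym2_elems (tvmul (tvinv x) x);
  tvinv_uniq : forall x y : X,
    tvone \in sym2_elems (tvmul x y) \/ tvone \in sym2_elems (tvmul y x) ->
    y = tvinv x
}.

#[short(type="twoValuedGroupType")]
HB.structure Definition TwoValuedGroup := {X of isTwoValuedGroup X & Choice X}.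

HB.mixin Record isTopologicalTwoValuedGroup X
    of Topological X & TwoValuedGroup X := {
  tvmul_continuous :
    continuous ((fun p => tvmul p.1 p.2) : X * X -> Sym2 X);
  tvinv_continuous : continuous (tvinv : X -> X)
}.

#[short(type="topologicalTwoValuedGroupType")]
HB.structure Definition TopologicalTwoValuedGroup :=
  {X of Topological X & TwoValuedGroup X & isTopologicalTwoValuedGroup X}.

Definition tv_isomorphic (X Y : topologicalTwoValuedGroupType) : Prop :=
  exists (f : X -> Y) (g : Y -> X),
    [/\ continuous f, continuous g, cancel f g, cancel g f &
     forall x y z1 z2 : X, tvmul x y = sym2 z1 z2 ->
       tvmul (f x) (f y) = sym2 (f z1) (f z2)].

Section special.
Variable X : twoValuedGroupType.

Definition tv_commutative : Prop := forall x y : X, tvmul x y = tvmul y x.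

Definition tv_involutive : Prop := forall x : X, tvinv x = x.

Definition tv_powers (x : X) : set (nat -> X) :=
  [set p | [/\ p 0%N = tvone, p 1%N = x &
    forall k : nat, (1 <= k)%N ->
      tvmul x (p k) = sym2 (p k.-1) (p k.+1) /\
      tvmul (p k) x = sym2 (p k.-1) (p k.+1)]].

(* the sequence is unique if it exists, which is the case when X is involutive *)
Definition tvpow (x : X) : nat -> X := xget (fun=> tvone) (tv_powers x).

(* [None] stands for infinite order *)
Definition tvord (x : X) : option nat :=
  if pselect (exists k : nat, (0 < k)%N && (tvpow x k == tvone)) is left ex_k
  then Some (ex_minn ex_k) else None.

Definition tvord_gt (n : nat) (x : X) : Prop :=
  if tvord x is Some k then (n < k)%N else True.

Definition tv_special : Prop :=
  exists x y : X, [/\ tvord_gt 2 x, tvord_gt 2 y &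
    exists z : X, tvmul x y = sym2 z z].

End special.

HB.mixin Record isBooleanGroup G of Group G := {
  boolean_order2 : forall x : G, x != 1 -> x ^+ 2 = 1
}.

#[short(type="booleanGroupType")]
HB.structure Definition BooleanGroup := {G of Group G & isBooleanGroup G}.

HB.mixin Record isTopologicalGroup G of Topological G & Group G := {
  mulg_continuous : continuous (fun p : G * G => p.1 * p.2);
  invg_continuous : continuous (fun x : G => x^-1)
}.

#[short(type="topologicalGroupType")]
HB.structure Definition TopologicalGroup :=
  {G of Topological G & Group G & isTopologicalGroup G}.

#[short(type="topologicalBooleanGroupType")]
HB.structure Definition TopologicalBooleanGroup :=
  {G of TopologicalGroup G & BooleanGroup G}.

(* linear independence over F_2, with scalars acting as exponents *)
Definition F2_free (V : booleanGroupType) n (v : 'I_n -> V) : Prop :=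
  forall c : 'I_n -> 'F_2,
    (\prod_(i < n) v i ^+ c i) = 1 -> forall i, c i = 0%R.

Definition F2_dim_ge (V : booleanGroupType) (n : nat) : Prop :=
  exists v : 'I_n -> V, F2_free v.

Definition group_isomorphic (G H : groupType) : Prop :=
  exists f : G -> H, bijective f /\ {morph f : x y / x * y}.

Definition topological_group_iso (G H : topologicalGroupType) (f : G -> H) :
    Prop :=
  exists g : H -> G, [/\ continuous f, continuous g, cancel f g, cancel g f &
    {morph f : x y / x * y}].

Lemma boolean_mulgg (G : booleanGroupType) (x : G) : x * x = 1.
Proof. by have [->|/boolean_order2] := eqVneq x 1; rewrite ?mulg1. Qed.

Lemma boolean_invg (G : booleanGroupType) (x : G) : x^-1 = x.
Proof. by apply: (mulgI x); rewrite mulgV boolean_mulgg. Qed.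

Lemma boolean_mulgC (G : booleanGroupType) (x y : G) : x * y = y * x.
Proof. by rewrite -[LHS]boolean_invg invgM !boolean_invg. Qed.

Lemma sym2_continuous (X : topologicalType) :
  continuous ((fun p => sym2 p.1 p.2) : X * X -> Sym2 X).
Proof.
rewrite (_ : (fun _ => _) = \pi_(Sym2 X)); first exact: pi_continuous.
by apply/funext => -[].
Qed.

Lemma pair_continuous_at (Z A B : topologicalType) (f : Z -> A) (g : Z -> B) z :
  {for z, continuous f} -> {for z, continuous g} ->
  {for z, continuous (fun x => (f x, g x))}.
Proof. by move=> fz gz; apply: cvg_pair; [exact: fz|exact: gz]. Qed.

Lemma fst_continuous (A B : topologicalType) :
  continuous (fst : A * B -> A).
Proof. by move=> p; apply: cvg_fst. Qed.

Lemma snd_continuous (A B : topologicalType) :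
  continuous (snd : A * B -> B).
Proof. by move=> p; apply: cvg_snd. Qed.

Lemma comp_continuous (A B C : topologicalType) (f : A -> B) (g : B -> C) :
  continuous f -> continuous g -> continuous (fun x => g (f x)).
Proof. by move=> fc gc x; apply: continuous_comp; [exact: fc|exact: gc]. Qed.

Section sum_topology.
Variables A B : topologicalType.

Definition sum_open (O : set (A + B)) : Prop :=
  open (inl @^-1` O : set A) /\ open (inr @^-1` O : set B).

Lemma sum_openT : sum_open setT.
Proof. by split; rewrite preimage_setT; exact: openT. Qed.

Lemma sum_openI : setI_closed sum_open.
Proof.
by move=> O P [O1 O2] [P1 P2]; split; rewrite preimage_setI; exact: openI.
Qed.

Lemma sum_open_bigU (I : Type) (f : I -> set (A + B)) :
  (forall i, sum_open (f i)) -> sum_open (\bigcup_i f i).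
Proof.
move=> fO; split; rewrite preimage_bigcup; apply: bigcup_open => i _.
  by have [] := fO i.
by have [] := fO i.
Qed.

HB.instance Definition _ := isOpenTopological.Build (A + B)%type
  sum_openT sum_openI sum_open_bigU.

End sum_topology.

Section sum_continuity.
Variables A B : topologicalType.

Lemma inl_continuous : continuous (inl : A -> A + B).
Proof. by apply/continuousP => O []. Qed.

Lemma inr_continuous : continuous (inr : B -> A + B).
Proof. by apply/continuousP => O []. Qed.

Lemma nbhs_inl (a : A) (P : set A) : nbhs a P -> nbhs (inl a : A + B) (inl @` P).
Proof.
rewrite nbhsE => -[O [oO Oa] OP]; apply: (@filterS _ _ _ (inl @` O)).
  exact: image_subset.
apply: open_nbhs_nbhs; split; last by exists a.
split; last first.
  have -> : inr @^-1` (inl @` O) = set0 :> set B by rewrite -subset0 => ? [].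
  exact: open0.
rewrite (_ : _ @^-1` _ = O) //.
apply/seteqP; split=> [x [y Oy [<-]]|x Ox] //.
by exists x.
Qed.

Lemma nbhs_inr (b : B) (P : set B) : nbhs b P -> nbhs (inr b : A + B) (inr @` P).
Proof.
rewrite nbhsE => -[O [oO Oa] OP]; apply: (@filterS _ _ _ (inr @` O)).
  exact: image_subset.
apply: open_nbhs_nbhs; split; last by exists b.
split.
  have -> : inl @^-1` (inr @` O) = set0 :> set A by rewrite -subset0 => ? [].
  exact: open0.
rewrite (_ : _ @^-1` _ = O) //.
apply/seteqP; split=> [x [y Oy [<-]]|x Ox] //.
by exists x.
Qed.

Lemma sum_pair_continuous (Z : topologicalType) (f : (A + B) * (A + B) -> Z) :
  continuous (fun p : A * A => f (inl p.1, inl p.2)) ->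
  continuous (fun p : A * B => f (inl p.1, inr p.2)) ->
  continuous (fun p : B * A => f (inr p.1, inl p.2)) ->
  continuous (fun p : B * B => f (inr p.1, inr p.2)) ->
  continuous f.
Proof.
move=> fll flr frl frr [[a|a] [b|b]] O Of.
- have [[P Q] [/= Pa Qb] PQ] := fll (a, b) O Of.
  exists (inl @` P, inl @` Q); first by split; exact: nbhs_inl.
  by move=> [_ _] [/= [x Px <-] [y Qy <-]]; exact: (PQ (x, y)).
- have [[P Q] [/= Pa Qb] PQ] := flr (a, b) O Of.
  exists (inl @` P, inr @` Q); first by split; [exact: nbhs_inl|exact: nbhs_inr].
  by move=> [_ _] [/= [x Px <-] [y Qy <-]]; exact: (PQ (x, y)).
- have [[P Q] [/= Pa Qb] PQ] := frl (a, b) O Of.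
  exists (inr @` P, inl @` Q); first by split; [exact: nbhs_inr|exact: nbhs_inl].
  by move=> [_ _] [/= [x Px <-] [y Qy <-]]; exact: (PQ (x, y)).
- have [[P Q] [/= Pa Qb] PQ] := frr (a, b) O Of.
  exists (inr @` P, inr @` Q); first by split; exact: nbhs_inr.
  by move=> [_ _] [/= [x Px <-] [y Qy <-]]; exact: (PQ (x, y)).
Qed.

End sum_continuity.

Section quotient.
Variables (U : topologicalBooleanGroupType) (s : U).

(* the subgroup <s>: nonnegative powers suffice since s has finite order *)
Definition cycle_set : set U := [set u | exists n : nat, u = s ^+ n].

Definition coset_rel : rel U := fun x y => `[< cycle_set (x^-1 * y) >].

Lemma coset_rel_equiv : equiv_class_of coset_rel.
Proof.
rewrite /coset_rel; split=> [x|x y|y x z /asboolP[n xy] /asboolP[m yz]].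
- by apply/asboolP; exists 0%N; rewrite mulVg.
- by congr asbool; rewrite !boolean_invg boolean_mulgC.
- by apply/asboolP; exists (n + m)%N; rewrite expgnDr -xy -yz -mulgA mulVKg.
Qed.

Canonical coset_equiv := EquivRelPack coset_rel_equiv.

Definition coset_space : Type := quotient_topology {eq_quot coset_equiv}.

Definition coset_proj (u : U) : coset_space := \pi_({eq_quot coset_equiv}) u.

Definition coset_repr (w : coset_space) : U :=
  repr (w : {eq_quot coset_equiv}).

Definition coset_mul (w1 w2 : coset_space) : coset_space :=
  coset_proj (coset_repr w1 * coset_repr w2).

Lemma coset_projK w : coset_proj (coset_repr w) = w.
Proof. exact: reprK. Qed.

Lemma cycle_setP (u : U) : cycle_set u <-> u = 1 \/ u = s.
Proof.
split=> [[n ->]|[->|->]]; last 2 first.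
- by exists 0%N.
- by exists 1%N.
elim: n => [|n [IHn|IHn]]; first by left.
- by right; rewrite expgS IHn mulg1.
- by left; rewrite expgS IHn boolean_mulgg.
Qed.

Lemma coset_projP (u v : U) :
  coset_proj u = coset_proj v <-> v = u \/ v = s * u.
Proof.
have E t : u^-1 * v = t <-> v = t * u.
  by split=> [<-|->]; [rewrite boolean_mulgC mulVKg|rewrite boolean_mulgC mulgK].
split=> [/eqmodP/asboolP/cycle_setP|H].
  by rewrite !E mul1g.
by apply/eqmodP/asboolP/cycle_setP; rewrite !E mul1g.
Qed.

Lemma coset_projM (u v : U) :
  coset_mul (coset_proj u) (coset_proj v) = coset_proj (u * v).
Proof.
have H t : coset_repr (coset_proj t) = t \/ coset_repr (coset_proj t) = s * t.
  by apply/coset_projP; rewrite coset_projK.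
have sK t : s * (s * t) = t by rewrite mulgA boolean_mulgg mul1g.
have sC t r : t * (s * r) = s * (t * r) by rewrite !mulgA (boolean_mulgC t).
rewrite /coset_mul; apply/coset_projP.
have [->|->] := H u; have [->|->] := H v; [left|right|right|left] => //.
- by rewrite sC sK.
- by rewrite -mulgA sK.
- by rewrite -mulgA sC !sK.
Qed.

End quotient.

Section quotient_continuity.
Variables (U : topologicalBooleanGroupType) (s : U).

Lemma coset_proj_continuous : continuous (@coset_proj U s).
Proof. exact: pi_continuous. Qed.

Lemma mulg_continuous_left (t : U) : continuous (fun x : U => t * x).
Proof.
move=> x; apply: (@continuous_comp _ _ _ (fun x => (t, x))
  (fun p : U * U => p.1 * p.2)); last exact: mulg_continuous.
by apply: cvg_pair; [exact: cvg_cst|exact: cvg_id].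
Qed.

Lemma coset_proj_open (O : set U) : open O -> open (@coset_proj U s @` O).
Proof.
move=> oO; rewrite /open /= /quotient_open.
rewrite (_ : _ @^-1` _ = O `|` (fun x => s * x) @^-1` O).
  by apply: openU => //; move/continuousP: (@mulg_continuous_left s); apply.
apply/seteqP; split=> [x [y Oy /coset_projP[->|->]]|x [Ox|Ox]].
- by left.
- by right => /=; rewrite mulgA boolean_mulgg mul1g.
- by exists x.
- by exists (s * x) => //; apply/coset_projP; right; rewrite mulgA boolean_mulgg mul1g.
Qed.

Lemma coset_mul_continuous :
  continuous (fun p : coset_space s * coset_space s => coset_mul p.1 p.2).
Proof.
move=> [w1 w2] O /=; rewrite -[w1]coset_projK -[w2]coset_projK coset_projM.
set u1 := coset_repr w1; set u2 := coset_repr w2 => Ou.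
have [|[P Q] [/= Pu Qu] PQ] := @mulg_continuous U (u1, u2) (@coset_proj U s @^-1` O).
  exact: (@coset_proj_continuous (u1 * u2)).
have H u (R : set U) : nbhs u R -> nbhs (coset_proj s u) (@coset_proj U s @` R).
  rewrite nbhsE => -[R' [oR' R'u] R'R].
  apply: (@filterS _ _ _ (@coset_proj U s @` R')); first exact: image_subset.
  by apply: open_nbhs_nbhs; split; [exact: coset_proj_open|exists u].
exists (@coset_proj U s @` P, @coset_proj U s @` Q); first by split; exact: H.
move=> [_ _] [/= [x Px <-] [y Qy <-]] /=; rewrite coset_projM.
exact: (PQ (x, y)).
Qed.

End quotient_continuity.

(* V is discrete, hence so is its subspace V \ {e} *)
Definition nonid (V : groupType) : Type := discrete_topology {v : V | v != 1}.
HB.instance Definition _ (V : groupType) := SubType.on (nonid V).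

(* [inl u] stands for (e, u) and [inr (v, w)] for (v, w) with v <> e *)
Definition Yspace (V : booleanGroupType) (U : topologicalBooleanGroupType)
  (s : U) : Type := (U + nonid V * coset_space s)%type.
HB.instance Definition _ V U s := Topological.copy (@Yspace V U s)
  (U + nonid V * coset_space s)%type.

Section twoValuedY.
Variables (V : booleanGroupType) (U : topologicalBooleanGroupType) (s : U).
Local Notation Y := (@Yspace V U s).

(* When v1 = v2, u and s * u are the two preimages of w1 * w2 in U. When
   v1 <> v2, v1 * v2 <> e and the default value of [insubd] is not used. *)
Definition Ymul (x y : Y) : Sym2 Y :=
  match x, y with
  | inl u1, inl u2 => sym2 (inl (u1 * u2) : Y) (inl (u1 * u2) : Y)
  | inl u, inr (v, w) | inr (v, w), inl u =>
      let z := inr (v, coset_mul (coset_proj s u) w) : Y in sym2 z z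
  | inr (v1, w1), inr (v2, w2) =>
      if v1 == v2 then
        let u := coset_repr (coset_mul w1 w2) in
        sym2 (inl u : Y) (inl (s * u) : Y)
      else
        let z := inr (insubd v1 (val v1 * val v2), coset_mul w1 w2) : Y in
        sym2 z z
  end.

Definition Yone : Y := inl 1.

Let q (v : V) (u : U) : Y :=
  if insub v is Some v' then inr (v', coset_proj s u) else inl u.

Let eps (v1 v2 : V) : U := if (v1 == 1) && (v2 == 1) then 1 else s.

Let q_surj (y : Y) : exists v u, y = q v u.
Proof.
case: y => [u|[v w]].
  by exists 1, u; rewrite /q insubF ?eqxx.
by exists (val v), (coset_repr w); rewrite /q valK coset_projK.
Qed.

Let q1 u : q 1 u = inl u.
Proof. by rewrite /q insubF ?eqxx. Qed.

Let qN v u (v1 : v != 1) : q v u = inr (Sub v v1, coset_proj s u).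
Proof. by rewrite /q insubT. Qed.

Let q_s v u : v != 1 -> q v (s * u) = q v u.
Proof.
move=> v1; rewrite !qN; congr (inr (_, _)); apply/coset_projP; right.
by rewrite mulgA boolean_mulgg mul1g.
Qed.

Let mulq v1 u1 v2 u2 : Ymul (q v1 u1) (q v2 u2) =
  sym2 (q (v1 * v2) (u1 * u2)) (q (v1 * v2) (eps v1 v2 * (u1 * u2))).
Proof.
rewrite /eps; have [->|v1N] := eqVneq v1 1; have [->|v2N] := eqVneq v2 1 => /=.
- by rewrite !mul1g !q1.
- by rewrite !mul1g q_s // q1 !(qN _ v2N) /= coset_projM.
- by rewrite !mulg1 q_s // q1 !(qN _ v1N) /= coset_projM boolean_mulgC.
- rewrite (qN u1 v1N) (qN u2 v2N) /= coset_projM.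
  have -> : (Sub v1 v1N == Sub v2 v2N :> nonid V) = (v1 == v2) by [].
  have [<-|v12] := eqVneq v1 v2.
    rewrite boolean_mulgg !q1.
    have : coset_proj s (u1 * u2) =
           coset_proj s (coset_repr (coset_proj s (u1 * u2))).
      by rewrite coset_projK.
    move=> /coset_projP[->|->] //.
    rewrite [s * (s * _)]mulgA boolean_mulgg mul1g.
    by apply/eqmodP; rewrite /= /swap_rel /= eqxx orbT.
  have v12N : v1 * v2 != 1.
    by apply: contra v12; rewrite mulg_eq1 boolean_invg.
  rewrite q_s // qN; congr sym2; congr (inr (_, _)); apply: val_inj;
    by rewrite val_insubd /= v12N.
Qed.

Let count_sym2 (p : pred Y) (a b : Y) :
  count p (sym2_elems (sym2 a b)) = (p a + p b)%N.
Proof. by rewrite (permP (sym2_elemsE a b)) /= addn0. Qed.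

Let count_bind (p : pred Y) (f : Y -> Sym2 Y) (a b : Y) :
  count p (flatten [seq sym2_elems (f t) | t <- sym2_elems (sym2 a b)]) =
  (count p (sym2_elems (f a)) + count p (sym2_elems (f b)))%N.
Proof.
have /(permP)-> := perm_flatten
  (perm_map (fun t => sym2_elems (f t)) (sym2_elemsE a b)).
by rewrite -count_cat; congr (count p).
Qed.

Let mem_sym2 (a b x : Y) : (x \in sym2_elems (sym2 a b)) = (x == a) || (x == b).
Proof. by rewrite (perm_mem (sym2_elemsE a b)) !inE. Qed.

Lemma YmulA (x y z : Y) :
  perm_eq (flatten [seq sym2_elems (Ymul x t) | t <- sym2_elems (Ymul y z)])
          (flatten [seq sym2_elems (Ymul t z) | t <- sym2_elems (Ymul x y)]).
Proof.
have [v1 [u1 ->]] := q_surj x; have [v2 [u2 ->]] := q_surj y.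
have [v3 [u3 ->]] := q_surj z.
apply/permP => p; rewrite !mulq (count_bind _ (Ymul _)).
rewrite (count_bind _ (Ymul ^~ _)) !mulq !count_sym2 !mulgA.
set v := v1 * v2 * v3.
rewrite -![_ * eps _ _ * _ * _]mulgA.
have sC (a b : U) : a * b = b * a by exact: boolean_mulgC.
rewrite ![u1 * eps _ _]sC -!mulgA.
set A := u1 * (u2 * u3).
have -> e : u1 * (e * (u2 * u3)) = e * A.
  by rewrite mulgA [u1 * e]sC -mulgA.
have sK (a : U) : s * (s * a) = a by rewrite mulgA boolean_mulgg mul1g.
have [v_eq1|vN] := eqVneq v 1; last first.
  have qe a b c : q v (eps a b * c) = q v c.
    by rewrite /eps; case: ifP => _; [rewrite mul1g|rewrite q_s].
  by rewrite !qe.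
have v3E : v3 = v1 * v2.
  by apply: (mulgI (v1 * v2)); rewrite boolean_mulgg.
have v23 : v2 * v3 = v1.
  by rewrite v3E boolean_mulgC -mulgA boolean_mulgg mulg1.
rewrite v_eq1 v23 -v3E /eps !andbb.
have [v1E|v1N] := eqVneq v1 1; have [v2E|v2N] := eqVneq v2 1.
- by rewrite v3E v1E v2E mulg1 eqxx /= !mul1g.
- have -> : (v3 == 1) = false by rewrite v3E v1E mul1g (negPf v2N).
  by rewrite /= ?mul1g ?sK; do 2!case: (p _).
- have -> : (v3 == 1) = false by rewrite v3E v2E mulg1 (negPf v1N).
  by rewrite /= ?mul1g ?sK; do 2!case: (p _).
- by case: ifP => _; rewrite /= ?mul1g ?sK; do 2!case: (p _).
Qed.

Lemma Ymul1x (x : Y) : Ymul Yone x = sym2 x x.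
Proof.
case: x => [u|[v w]] /=; first by rewrite mul1g.
by rewrite -[w]coset_projK coset_projM mul1g.
Qed.

Lemma YmulC (x y : Y) : Ymul x y = Ymul y x.
Proof.
have [v1 [u1 ->]] := q_surj x; have [v2 [u2 ->]] := q_surj y.
by rewrite !mulq boolean_mulgC (boolean_mulgC u1) /eps andbC.
Qed.

Lemma Ymulx1 (x : Y) : Ymul x Yone = sym2 x x.
Proof. by rewrite YmulC Ymul1x. Qed.

Lemma Ymulxx (x : Y) : Yone \in sym2_elems (Ymul x x).
Proof.
have [v [u ->]] := q_surj x.
by rewrite mulq !boolean_mulgg mem_sym2 q1 eqxx.
Qed.

Lemma Yinv_uniq (x y : Y) :
  Yone \in sym2_elems (Ymul x y) \/ Yone \in sym2_elems (Ymul y x) -> y = x.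
Proof.
rewrite [Ymul y x]YmulC => H.
have {H} : Yone \in sym2_elems (Ymul x y) by case: H.
have [v1 [u1 ->]] := q_surj x; have [v2 [u2 ->]] := q_surj y.
rewrite mulq mem_sym2.
have qone v u : Yone = q v u -> v = 1 /\ u = 1.
  by have [->|vN] := eqVneq v 1; rewrite ?q1 ?qN // => -[].
have E (G : booleanGroupType) (a b : G) : a * b = 1 -> b = a.
  by move=> ab; apply: (mulgI a); rewrite boolean_mulgg.
move=> /orP[] /eqP /qone[/E-> /E]; first by move->.
rewrite /eps andbb; case: ifP => [_|/negbT v1N]; first by move/E->.
move=> us; have -> : u2 = s * u1.
  by rewrite -us boolean_mulgC mulgA boolean_mulgg mul1g.
exact: q_s.
Qed.

Let double_continuous (Z : topologicalType) (f : Z -> Y) :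
  continuous f -> continuous ((fun z => sym2 (f z) (f z)) : Z -> Sym2 Y).
Proof.
move=> fc z; apply: (@continuous_comp _ _ _ (fun z => (f z, f z))
  (fun p : Y * Y => sym2 p.1 p.2)); last exact: sym2_continuous.
by apply: pair_continuous_at => /=; exact: fc.
Qed.

Let act_continuous : continuous
  (fun p : U * (nonid V * coset_space s) =>
     inr (p.2.1, coset_mul (coset_proj s p.1) p.2.2) : Y).
Proof.
move=> p; apply: (@continuous_comp _ _ _
  (fun p => (p.2.1, coset_mul (coset_proj s p.1) p.2.2)) (inr : _ -> Y));
  last exact: inr_continuous.
apply: pair_continuous_at => /=.
  exact: (comp_continuous (@snd_continuous _ _) (@fst_continuous _ _)).
apply: (@continuous_comp _ _ _ (fun p => (coset_proj s p.1, p.2.2))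
  (fun p => coset_mul p.1 p.2)); last exact: coset_mul_continuous.
apply: pair_continuous_at => /=.
  exact: (comp_continuous (@fst_continuous _ _) (@coset_proj_continuous _ s)).
exact: (comp_continuous (@snd_continuous _ _) (@snd_continuous _ _)).
Qed.

Let fiber_continuous :
  continuous ((fun w => sym2 (inl (coset_repr w)) (inl (s * coset_repr w))) :
    coset_space s -> Sym2 Y).
Proof.
apply/(quotient_continuous (Q0 := {eq_quot coset_equiv s})).
rewrite (_ : _ \o _ = fun u => sym2 (inl u : Y) (inl (s * u) : Y)).
  move=> u; apply: (@continuous_comp _ _ _ (fun u => (inl u : Y, inl (s * u) : Y))
    (fun p : Y * Y => sym2 p.1 p.2)); last exact: sym2_continuous.
  apply: pair_continuous_at; first exact: inl_continuous.
  apply: (@continuous_comp _ _ _ (fun u => s * u) (inl : _ -> Y)).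
    exact: mulg_continuous_left.
  exact: inl_continuous.
apply/funext => u /=.
have : coset_proj s u = coset_proj s (coset_repr (coset_proj s u)).
  by rewrite coset_projK.
move=> /coset_projP[] E; rewrite [coset_repr _]E //.
rewrite mulgA boolean_mulgg mul1g.
by apply/eqmodP; rewrite /= /swap_rel /= eqxx orbT.
Qed.

Lemma Ymul_continuous : continuous ((fun p => Ymul p.1 p.2) : Y * Y -> Sym2 Y).
Proof.
apply: sum_pair_continuous => /=.
- apply: (@double_continuous _ (fun p : U * U => inl (p.1 * p.2))) => p.
  apply: (@continuous_comp _ _ _ (fun p : U * U => p.1 * p.2) (inl : _ -> Y)).
    exact: mulg_continuous.
  exact: inl_continuous.
- rewrite (_ : (fun _ => _) = (fun p : U * (nonid V * coset_space s) =>
    let z := inr (p.2.1, coset_mul (coset_proj s p.1) p.2.2) : Y in sym2 z z)).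
    exact: (double_continuous act_continuous).
  by apply/funext => -[u [v w]].
- rewrite (_ : (fun _ => _) = (fun p : U * (nonid V * coset_space s) =>
    let z := inr (p.2.1, coset_mul (coset_proj s p.1) p.2.2) : Y in sym2 z z)
    \o (fun p : (nonid V * coset_space s) * U => (p.2, p.1))); last first.
    by apply/funext => -[[v w] u].
  move=> p; apply: continuous_comp; last exact: (double_continuous act_continuous).
  by apply: pair_continuous_at; [exact: cvg_snd|exact: cvg_fst].
- move=> [[v1 w1] [v2 w2]].
  pose m (p : (nonid V * coset_space s) * (nonid V * coset_space s)) :=
    coset_mul p.1.2 p.2.2.
  have m_cont : continuous m.
    move=> p; apply: (@continuous_comp _ _ _ (fun p => (p.1.2, p.2.2))
      (fun p => coset_mul p.1 p.2)); last exact: coset_mul_continuous.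
    apply: pair_continuous_at.
      exact: (comp_continuous (@fst_continuous _ _) (@snd_continuous _ _)).
    exact: (comp_continuous (@snd_continuous _ _) (@snd_continuous _ _)).
  pose f (w : coset_space s) : Sym2 Y :=
    if v1 == v2 then sym2 (inl (coset_repr w) : Y) (inl (s * coset_repr w) : Y)
    else let z := inr (insubd v1 (val v1 * val v2), w) : Y in sym2 z z.
  have f_cont : continuous f.
    rewrite /f; case: (v1 == v2); first exact: fiber_continuous.
    apply: double_continuous.
    apply: (@comp_continuous _ (nonid V * coset_space s)%type Y
      (fun w => (insubd v1 (val v1 * val v2), w)) inr); last exact: inr_continuous.
    by move=> w; apply: pair_continuous_at; [apply: cst_continuous|apply: cvg_id].
  have fm_cont : {for (v1, w1, (v2, w2)), continuous (f \o m)}.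
    by apply: continuous_comp; [exact: m_cont|exact: f_cont].
  apply: cvg_trans fm_cont; apply: near_eq_cvg.
  exists (fst @^-1` [set v1], fst @^-1` [set v2]).
    by split; apply: cvg_fst; exact: discrete_set1.
  by move=> [[v1' w1'] [v2' w2']] /= [-> ->].
Qed.

HB.instance Definition _ := isTwoValuedGroup.Build Y
  YmulA Ymul1x Ymulx1 Ymulxx Ymulxx Yinv_uniq.

Lemma Yinv_continuous : continuous (tvinv : Y -> Y).
Proof. by move=> y; exact: cvg_id. Qed.

HB.instance Definition _ := isTopologicalTwoValuedGroup.Build Y
  Ymul_continuous Yinv_continuous.

End twoValuedY.

(* Main.v *)
(* Let I be the set of x with x * x = [e, e]. Associativity applied to
   (x * x) * y shows that x * y = [t, t] for x in I, so that I is a Boolean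
   group acting on X. If x, y lie outside I and x * y = [z, z], then x, y and
   z have the same square s, s lies in I and fixes all three of them. The
   elements c outside I fixed by s are exactly those with c * c = [e, s], and
   together with I they are closed under multiplication. No a outside I is
   moved by s: for c fixed by s, multiplication by c would turn the square of
   a into s times itself; using c = x, c = y and c = z, s fixes the square b of
   a, and comparing multiplicities in (a * p) * p, p in c * a, then gives
   c in I b. For c = x and c = y this forces x * y to meet I, a contradiction.
   Hence X / <s> is a Boolean group containing I / <s>; by Zorn's lemma I / <s>
   has a complement V, which lifts to X because s acts trivially outside I. The
   map (v, u) |-> u v from Y_{V, I, s} to X is the required isomorphism; I is
   open as the set of points moved by s, and each coset I v is open as the set
   of x with x * v inside I.
   Conversely U, s and V are recovered from Y_{V, U, s}: U is the set of y with
   y * y = [e, e], [e, s] is the square of any other element, and V = Y / U. *)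

Require Import Defs.
From HB Require Import structures.
From mathcomp Require Import all_boot all_algebra all_classical topology zify.

Set Implicit Arguments.
Unset Strict Implicit.
Unset Printing Implicit Defensive.

Local Open Scope classical_set_scope.
Local Open Scope quotient_scope.
Local Open Scope group_scope.

(** * Two-element multisets *)

Section Sym2.
Variable X : choiceType.
Implicit Types (a b c d t : X) (z : Sym2 X) (f : X -> nat).

(* Sums of functions separate multisets, which reduces identities between
   four-element multisets to linear arithmetic. *)
Definition sym2_sum z f : nat := (\sum_(t <- sym2_elems z) f t)%N.

Lemma sym2_sumE a b f : sym2_sum (sym2 a b) f = (f a + f b)%N.
Proof.
by rewrite /sym2_sum (perm_big _ (sym2_elemsE a b)) /= !big_cons big_nil addn0.
Qed.

Lemma sym2C a b : sym2 a b = sym2 b a.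
Proof. by apply/eqmodP; rewrite /= /swap_rel /= eqxx orbT. Qed.

Lemma sym2_surj z : exists a b, z = sym2 a b.
Proof.
exists (repr (z : {eq_quot swap_equiv X})).1.
exists (repr (z : {eq_quot swap_equiv X})).2.
by rewrite /sym2 -surjective_pairing reprK.
Qed.

Lemma sym2_eq a b c d :
  sym2 a b = sym2 c d -> (a = c /\ b = d) \/ (a = d /\ b = c).
Proof.
by move=> /eqmodP /= /orP[] /eqP[-> ->]; auto.
Qed.

Lemma sym2_diag a b c : sym2 a b = sym2 c c -> a = c /\ b = c.
Proof. by move=> /sym2_eq[] []. Qed.

(** Testing with the indicators of [a] and then of [b] recovers both entries. *)
Lemma sym2_sum_inj a b z :
  (forall f, f a + f b = sym2_sum z f)%N -> sym2 a b = z.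
Proof.
have [c [d ->]] := sym2_surj z => H.
have {}H f : (f a + f b = f c + f d)%N by rewrite H sym2_sumE.
have := H (fun t => (t == a) : nat); rewrite eqxx.
have [ca|ca] := eqVneq c a => [_|].
  subst c; have := H (fun t => (t == b) : nat); rewrite eqxx.
  by have [->//|db] := eqVneq d b; lia.
have [da|da] := eqVneq d a => [_|]; last by lia.
subst d; have := H (fun t => (t == b) : nat); rewrite eqxx.
by have [->//|db] := eqVneq c b; [rewrite sym2C|lia].
Qed.

Definition sym2_in t z := exists b, z = sym2 t b.

Lemma sym2_in_pair t a b : sym2_in t (sym2 a b) <-> t = a \/ t = b.
Proof.
split=> [[c /sym2_eq[] []]|[]->]; [by left|by right|by exists b|].
by exists a; rewrite sym2C.
Qed.

Lemma sym2_inP t z : reflect (sym2_in t z) (t \in sym2_elems z).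
Proof.
suff E : t \in sym2_elems z <-> sym2_in t z by apply: (iffP idP) => /E.
have [a [b ->]] := sym2_surj z.
rewrite (perm_mem (sym2_elemsE a b)) !inE sym2_in_pair.
by split=> [/orP[]/eqP->|[]->]; rewrite ?eqxx ?orbT; auto.
Qed.

Lemma sym2_sum_gt0 z f :
  (0 < sym2_sum z f)%N <-> exists2 t, sym2_in t z & (0 < f t)%N.
Proof.
have [a [b ->]] := sym2_surj z; rewrite sym2_sumE addn_gt0; split.
  by move=> /orP[?|?]; [exists a|exists b] => //; apply/sym2_in_pair; auto.
by move=> [t /sym2_in_pair[]-> ->]; rewrite ?orbT.
Qed.

End Sym2.

(** * Involutive commutative two-valued groups *)

Section Involutive.
Variable X : twoValuedGroupType.
Hypotheses (X_inv : tv_involutive X) (X_comm : tv_commutative X).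
Implicit Types (a b c d g h p t u v x y z : X) (f : X -> nat).

Local Notation e := (@tvone X).
Local Notation "x ** y" := (tvmul x y) (at level 40).

Lemma tv_sumA x y z f :
  sym2_sum (y ** z) (fun t => sym2_sum (x ** t) f) =
  sym2_sum (x ** y) (fun t => sym2_sum (t ** z) f).
Proof.
have H w (k : X -> Sym2 X) : sym2_sum w (fun t => sym2_sum (k t) f) =
    (\sum_(r <- flatten [seq sym2_elems (k t) | t <- sym2_elems w]) f r)%N.
  by rewrite /sym2_sum big_flatten big_map.
rewrite (H _ (fun t => x ** t)) (H _ (fun t => t ** z)).
by rewrite (perm_big _ (tvmulA x y z)).
Qed.

Lemma tv_sumA4 x y z a b c d f : y ** z = sym2 a b -> x ** y = sym2 c d ->
  (sym2_sum (x ** a) f + sym2_sum (x ** b) f =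
   sym2_sum (c ** z) f + sym2_sum (d ** z) f)%N.
Proof. by move=> yz xy; have := tv_sumA x y z f; rewrite yz xy !sym2_sumE. Qed.

Lemma tv_inA x y z p r : sym2_in p (y ** z) -> sym2_in r (x ** p) ->
  exists2 t, sym2_in t (x ** y) & sym2_in r (t ** z).
Proof.
move=> py rx; have := tv_sumA x y z (fun t => (t == r) : nat) => E.
have : (0 < sym2_sum (x ** y)
    (fun t => sym2_sum (t ** z) (fun t => (t == r) : nat)))%N.
  rewrite -E; apply/sym2_sum_gt0; exists p => //.
  by apply/sym2_sum_gt0; exists r; rewrite ?eqxx.
move=> /sym2_sum_gt0[t tx /sym2_sum_gt0[q qt]].
by case: eqVneq qt => // -> rt _; exists t.
Qed.

Definition tvsq x : X := xget e [set t | x ** x = sym2 e t].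

Lemma tvsqE x : x ** x = sym2 e (tvsq x).
Proof.
have /sym2_inP[t xt] := tvmulxV x; rewrite X_inv in xt.
exact: (@xgetI _ e [set t | x ** x = sym2 e t] t).
Qed.

Lemma tv_in1 x y : sym2_in e (x ** y) -> x = y.
Proof.
move=> /sym2_inP H; rewrite (@tvinv_uniq _ y x) ?X_inv //.
by right.
Qed.

(* the set I; it contains e *)
Definition invol x : Prop := tvsq x = e.

(** Comparing multiplicities of [e] across associativity drives the next lemmas; off the diagonal
    [e] is absent because inverses are unique. *)
Lemma sum_indicator1 x y : sym2_sum (x ** y) (fun t => (t == e) : nat) =
  (if x == y then (tvsq x == e).+1 else 0)%N.
Proof.
have [<-|xy] := eqVneq x y.
  by rewrite tvsqE sym2_sumE eqxx.
apply/eqP; rewrite -leqn0 leqNgt; apply/negP => /sym2_sum_gt0[t te].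
by case: eqVneq te => // -> /tv_in1 /eqP; rewrite (negPf xy).
Qed.

(** If [z] lies in [x ** y], then [e] occurs in [(x ** y) ** z], hence in [x ** (y ** z)], so [x]
    must be an entry of [y ** z]. *)
Lemma tv_in_rot x y z : sym2_in z (x ** y) -> sym2_in x (y ** z).
Proof.
move=> zxy; have [a [b yz]] := sym2_surj (y ** z).
have [c zc] := zxy; have := tv_sumA4 (fun t => (t == e) : nat) yz zc.
rewrite yz !sum_indicator1 eqxx => H; apply/sym2_in_pair.
have [->|xa] := eqVneq x a; first by left.
have [->|xb] := eqVneq x b; first by right.
by move: H; rewrite (negPf xa) (negPf xb).
Qed.

Lemma tv_in_swap x y z : sym2_in z (x ** y) -> sym2_in y (x ** z).
Proof. by rewrite X_comm => /tv_in_rot. Qed.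

(** Count [e] in [x ** (y ** z) = (x ** y) ** z]. The right side is two copies of [z ** z], with 2
    or 4 occurrences; since [x] is outside I, the left side has one for each entry of [y ** z] equal
    to [x]. Equality forces 2 on both sides. *)
Lemma tv_triple x y z : ~ invol x -> x ** y = sym2 z z ->
  ~ invol z /\ y ** z = sym2 x x.
Proof.
move=> /eqP xN xyz; have [a [b yz]] := sym2_surj (y ** z).
have := tv_sumA4 (fun t => (t == e) : nat) yz xyz.
rewrite !sum_indicator1 eqxx (negPf xN) yz.
have [<-|xa] := eqVneq x a; have [<-|xb] := eqVneq x b; case: eqVneq => // /eqP H _.
by split => //; apply/eqP.
Qed.

(* meaningful for u in I only; otherwise possibly the default value e *)
Definition act u x : X := xget e [set t | u ** x = sym2 t t].

Lemma actE u x : invol u -> u ** x = sym2 (act u x) (act u x).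
Proof.
move=> uI; suff [t xt] : exists t, u ** x = sym2 t t.
  exact: (@xgetI _ e [set t | u ** x = sym2 t t] t).
(* Here [u ** (u ** y)] consists of four copies of [y], so an entry [a] of [u ** y] satisfies [u **
   a = [y, y]]; using this twice makes [u ** x] a double. *)
have H y a b : u ** y = sym2 a b -> u ** a = sym2 y y.
  move=> uy; have [c [d ua]] := sym2_surj (u ** a).
  have [c' [d' ub]] := sym2_surj (u ** b).
  have uu : u ** u = sym2 e e by rewrite tvsqE uI.
  have E f := tv_sumA4 f uy uu; rewrite ua ub tvmul1x in E.
  have {}E f : (f c + f d + (f c' + f d') = f y + f y + (f y + f y))%N.
    by have := E f; rewrite !sym2_sumE.
  have := E (fun t => (t != y) : nat); rewrite eqxx /=.
  have [cy|_] := eqVneq c y; have [dy|_] := eqVneq d y => // _.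
  by rewrite ua cy dy.
have [a [b ux]] := sym2_surj (u ** x); exists a.
exact: H (H _ _ _ ux).
Qed.

Lemma in_act u x t : invol u -> sym2_in t (u ** x) -> t = act u x.
Proof. by move=> uI; rewrite actE // => /sym2_in_pair[]. Qed.

Lemma act_in u x : invol u -> sym2_in (act u x) (u ** x).
Proof. by move=> uI; rewrite actE //; exists (act u x). Qed.

Lemma invol_in t x y : invol t -> sym2_in t (x ** y) -> y = act t x.
Proof. by move=> tI txy; apply: in_act => //; exact/tv_in_rot/tv_in_rot. Qed.

Lemma invol1 : invol e.
Proof. by have := tvmul1x e; rewrite tvsqE => /sym2_diag[]. Qed.

Lemma act1 x : act e x = x.
Proof. by have := actE x invol1; rewrite tvmul1x => /sym2_diag[]. Qed.

Lemma actx1 u : invol u -> act u e = u.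
Proof. by move=> uI; have := actE e uI; rewrite tvmulx1 => /sym2_diag[]. Qed.

(** This is associativity for [u], [x], [y], in which the doubles [u ** t] count everything
    twice. *)
Lemma act_mull u x y a b : invol u -> x ** y = sym2 a b ->
  act u x ** y = sym2 (act u a) (act u b).
Proof.
move=> uI xy; apply/esym/sym2_sum_inj => f.
have := tv_sumA4 f xy (actE x uI); rewrite !(actE _ uI) !sym2_sumE.
lia.
Qed.

Lemma act_mulr u x y a b : invol u -> x ** y = sym2 a b ->
  x ** act u y = sym2 (act u a) (act u b).
Proof. by move=> uI xy; rewrite X_comm; apply: act_mull; rewrite // X_comm. Qed.

Lemma invol_mul u : invol u -> u ** u = sym2 e e.
Proof. by move=> uI; rewrite tvsqE uI. Qed.

Lemma invol_act u v : invol u -> invol v -> invol (act u v).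
Proof.
move=> uI vI; have := act_mulr uI (act_mull uI (invol_mul vI)).
rewrite tvsqE actx1 // => E.
have uu : act u u = e by have := actE u uI; rewrite invol_mul // => /sym2_diag[].
by move: E; rewrite uu => /sym2_diag[].
Qed.

Lemma actA u v x : invol u -> invol v -> act u (act v x) = act (act u v) x.
Proof.
move=> uI vI; have := act_mull uI (actE x vI).
by rewrite (actE _ (invol_act uI vI)) => /sym2_diag[].
Qed.

Lemma actC u v : invol u -> invol v -> act u v = act v u.
Proof.
by move=> uI vI; have := actE v uI; rewrite X_comm actE // => /sym2_diag[].
Qed.

Lemma actCA u v x : invol u -> invol v -> act u (act v x) = act v (act u x).
Proof. by move=> uI vI; rewrite !actA // (actC uI). Qed.

Lemma actuu u : invol u -> act u u = e.
Proof. by move=> uI; have := actE u uI; rewrite invol_mul // => /sym2_diag[]. Qed.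

Lemma actK u : invol u -> involutive (act u).
Proof. by move=> uI x; rewrite actA // actuu // act1. Qed.

(** By [tv_triple], [x ** z = [y, y]]; comparing [x ** (x ** y)] with [(x ** x) ** y] then makes the
    square of [x] fix [y]. A square s outside I would, by [tv_triple] again, give [y ** y = [s, s]],
    which could not contain [e]. *)
Lemma tv_double_sq x y z : ~ invol x -> ~ invol y -> x ** y = sym2 z z ->
  [/\ invol (tvsq x), act (tvsq x) y = y & tvsq y = tvsq x].
Proof.
move=> xN yN xy; have [zN yz] := tv_triple xN xy.
have [_ xz] : ~ invol z /\ x ** z = sym2 y y.
  by apply: tv_triple => //; rewrite X_comm.
have sy : tvsq x ** y = sym2 y y.
  apply/esym/sym2_sum_inj => f; have := tv_sumA4 f xy (tvsqE x).
  by rewrite xz tvmul1x !sym2_sumE; lia.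
have sI : invol (tvsq x).
  apply: contrapT => sN; have [_] := tv_triple sN sy.
  by rewrite tvsqE => /sym2_diag[se _]; apply: sN; rewrite -se; exact: invol1.
have sy' : sym2_in (tvsq x) (y ** y) by apply: tv_in_rot; rewrite sy; exists y.
split => //; first by have := actE y sI; rewrite sy => /sym2_diag[].
by move: sy'; rewrite tvsqE => /sym2_in_pair[/xN|].
Qed.

(** * Elements fixed and elements moved by a nontrivial s in I *)

Section Double.
Variable s : X.
Hypotheses (sI : invol s) (s_neq1 : s <> e).

(** In the group I, multiplication by [s <> e] has no fixed point. *)
Lemma act_fix_not_invol c : act s c = c -> ~ invol c.
Proof.
move=> sc cI; apply: s_neq1.
by have := actK cI s; rewrite [act c s]actC // sc actuu.
Qed.

(** By rotation, [c] lies in [s ** c] exactly when [s] lies in [c ** c]. *)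
Lemma act_fixP c : ~ invol c -> act s c = c <-> tvsq c = s.
Proof.
move=> cN; split=> sc.
  have : sym2_in s (c ** c).
    by apply: tv_in_rot; rewrite -[X in sym2_in X _]sc; exact: act_in.
  by rewrite tvsqE => /sym2_in_pair[/s_neq1|].
have : sym2_in c (s ** c).
  by apply/tv_in_rot/tv_in_rot; rewrite tvsqE sc; exists e; rewrite sym2C.
by move/(in_act sI).
Qed.

Lemma tvsq_fix c : act s c = c -> tvsq c = s.
Proof. by move=> sc; apply/act_fixP => //; exact: act_fix_not_invol. Qed.

Lemma mul_fix c : act s c = c -> c ** c = sym2 e s.
Proof. by move=> /tvsq_fix sc; rewrite tvsqE sc. Qed.

Lemma act_fix_act u c : invol u -> act s c = c -> act s (act u c) = act u c.
Proof. by move=> uI sc; rewrite actCA // sc. Qed.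

Lemma act_in_mull x y t : act s x = x -> sym2_in t (x ** y) ->
  sym2_in (act s t) (x ** y).
Proof.
move=> sx [b xy]; have := act_mull sI xy; rewrite sx => ->.
by exists (act s b).
Qed.

(** As [p ** p = [e, s]] and [s] fixes [g], the product [g ** (p ** p)] is four copies of [g]. *)
Lemma mul_fix_back g p t : act s g = g -> act s p = p ->
  sym2_in t (g ** p) -> t ** p = sym2 g g.
Proof.
move=> sg sp [t' gp].
have [a [b tp]] := sym2_surj (t ** p); have [c [d t'p]] := sym2_surj (t' ** p).
have E f : (f g + f g + (f g + f g) = f a + f b + (f c + f d))%N.
  have := tv_sumA4 f (mul_fix sp) gp.
  by rewrite tp t'p tvmulx1 X_comm (actE _ sI) sg !sym2_sumE.
have := E (fun t => (t != g) : nat); rewrite eqxx /= tp.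
by have [->|] := eqVneq a g; have [->|] := eqVneq b g.
Qed.

(** The double [t ** p = [g, g]] makes [t], when outside I, share the square [s] of [p]. *)
Lemma mul_fix_closed g p t : act s g = g -> act s p = p ->
  sym2_in t (g ** p) -> act s t = t \/ invol t.
Proof.
move=> sg sp /(mul_fix_back sg sp) tp.
have [tI|tN] := pselect (invol t); [by right|left].
have [_ _ E] := tv_double_sq tN (act_fix_not_invol sp) tp.
by apply/act_fixP => //; rewrite -E; exact: tvsq_fix.
Qed.

(** Rotation puts [a] in [g ** p], so a [p] in I or fixed by [s] would force [a] into I or make it
    fixed. The other entry is [act s p] because [s] fixes [g]. *)
Lemma mul_fix_moved a g p : ~ invol a -> act s a <> a ->
  act s g = g -> sym2_in p (g ** a) ->
  [/\ ~ invol p, act s p <> p & g ** a = sym2 p (act s p)].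
Proof.
move=> aN sa sg pga; have apg : sym2_in a (g ** p) := tv_in_swap pga.
have pN : ~ invol p.
  move=> pI; apply: sa.
  have -> : a = act p g by apply: in_act => //; rewrite X_comm.
  exact: act_fix_act.
have sp : act s p <> p.
  by move=> sp; have [] := mul_fix_closed sg sp apg.
split => //; have [q ga] := pga; have := act_in_mull sg pga.
by rewrite ga => /sym2_in_pair[/sp//|<-].
Qed.

(** Since [g] lies in [a ** p] and [act s a] in [g ** p], the element [act s a] must occur in
    [a ** (p ** p)], and only [a ** tvsq p] can supply it. *)
Lemma tvsq_mul_fix_moved a g p : ~ invol a -> act s a <> a ->
  act s g = g -> sym2_in p (g ** a) -> tvsq p = act s (tvsq a).
Proof.
move=> aN sa sg pga; have [pN sp ga] := mul_fix_moved aN sa sg pga.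
have [_ _ gp] := mul_fix_moved pN sp sg (tv_in_swap pga).
have [h ap] : sym2_in g (a ** p) by apply: tv_in_rot.
have E f := tv_sumA4 f (tvsqE p) ap.
have sap : sym2_in (act s a) (a ** tvsq p).
  have := E (fun t => (t == act s a) : nat); rewrite tvmulx1 gp !sym2_sumE eqxx.
  have -> : (a == act s a) = false by apply/eqP/nesym.
  rewrite /= !add0n => E1.
  have /sym2_sum_gt0[t tap] :
      (0 < sym2_sum (a ** tvsq p) (fun t => (t == act s a) : nat))%N.
    by rewrite E1.
  by case: eqVneq => // <-.
(* So [tvsq p] is an entry of [a ** act s a], that is [s] or [act s (tvsq a)]; it is not [s], as [p]
   is moved. *)
have := tv_in_swap sap; rewrite (act_mulr sI (tvsqE a)) => /sym2_in_pair[] // E1.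
by case: sp; apply/act_fixP => //; rewrite E1 actx1.
Qed.

Lemma moved_fix_sq a g : ~ invol a -> act s a <> a ->
  act s g = g -> act s (tvsq a) = tvsq a ->
  exists2 h, invol h & g = act h (tvsq a).
Proof.
move=> aN sa sg sb; set b := tvsq a in sb *.
have [p [q ga]] := sym2_surj (g ** a).
have pga : sym2_in p (g ** a) by exists q.
have [pN sp {q}{}ga] := mul_fix_moved aN sa sg pga.
have [_ _ gp] := mul_fix_moved pN sp sg (tv_in_swap pga).
have pb : tvsq p = b by rewrite (tvsq_mul_fix_moved aN sa sg pga).
have [h ap] : sym2_in g (a ** p) by apply: tv_in_rot.
have hap : sym2_in h (a ** p) by rewrite ap sym2C; exists g.
(* [h] occurs in [a ** (a ** g) = (a ** a) ** g], whose entries are [g] and those of [b ** g], with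
   [b] and [g] fixed. *)
have hH : act s h = h \/ invol h.
  have pag : sym2_in p (a ** g) by rewrite X_comm.
  have [t] := tv_inA pag hap; rewrite tvsqE => /sym2_in_pair[]->.
    by rewrite tvmul1x => /sym2_in_pair[]->; left.
  exact: mul_fix_closed.
case: hH => [sh|hI]; last first.
  (* When [h] is in I, [p] is [act h a], and [a ** p] is [h] times [[e, b]]. *)
  exists h => //; have pa : p = act h a by exact: invol_in.
  have := act_mulr hI (tvsqE a); rewrite -pa ap actx1 // => /sym2_eq[] [] //.
  by move=> gh; case: (act_fix_not_invol sg); rewrite gh.
have [r hp] : exists r, h ** p = sym2 r (act s r).
  have [r [q hp]] := sym2_surj (h ** p); exists r.
  by have [] // := @mul_fix_moved p h r pN sp sh; exists q.
have ab : a ** b = sym2 a (act s a).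
  rewrite X_comm; have [] // := @mul_fix_moved a b a aN sa sb.
  by rewrite X_comm; apply: tv_in_rot; rewrite tvsqE; exists e; rewrite sym2C.
(* a and s a have the same multiplicity in (a * p) * p, but not in a * (p * p) *)
have := tv_sumA4 (fun t => (t == a) : nat) (tvsqE p) ap.
have := tv_sumA4 (fun t => (t == act s a) : nat) (tvsqE p) ap.
rewrite pb tvmulx1 gp hp ab !sym2_sumE !eqxx.
have ra : (r == act s a) = (act s r == a) by rewrite (can2_eq (actK sI) (actK sI)).
have ra' : (act s r == act s a) = (r == a) by rewrite (can_eq (actK sI)).
have -> : (a == act s a) = false by apply/eqP/nesym.
have -> : (act s a == a) = false by apply/eqP.
by rewrite ra ra' => /=; do 2!case: (_ == a).
Qed.

Lemma double_fix x y z a : ~ invol x -> ~ invol y -> x ** y = sym2 z z ->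
  tvsq x = s -> ~ invol a -> act s a = a.
Proof.
move=> xN yN xy xs aN; apply: contrapT => sa.
have [_ _ ys] := tv_double_sq xN yN xy.
have [zN yz] := tv_triple xN xy.
have [_ _ zs] := tv_double_sq yN zN yz.
have {ys}sy : act s y = y by apply/act_fixP; rewrite // ys.
have {}sx : act s x = x by apply/act_fixP.
have {zs}sz : act s z = z by apply/act_fixP; rewrite // zs; exact: tvsq_fix.
(* [r] is reached from [a] through [x] and then [y], which multiplies the square by [s] twice, and
   also through [z], which does so once. *)
have sb : act s (tvsq a) = tvsq a.
  have [p [p' xa]] := sym2_surj (x ** a).
  have pxa : sym2_in p (x ** a) by exists p'.
  have [r [r' yp]] := sym2_surj (y ** p).
  have ryp : sym2_in r (y ** p) by exists r'.
  have [pN sp _] := mul_fix_moved aN sa sx pxa.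
  have rs := tvsq_mul_fix_moved pN sp sy ryp.
  have [t] := tv_inA pxa ryp; rewrite X_comm xy => tz.
  have {tz}-> : t = z by case/sym2_in_pair: tz.
  move/(tvsq_mul_fix_moved aN sa sz) => <-.
  by rewrite rs (tvsq_mul_fix_moved aN sa sx pxa) actK.
have [h hI xh] := moved_fix_sq aN sa sx sb.
have [k kI yk] := moved_fix_sq aN sa sy sb.
(* [x] and [y] both lie in I b, so [x ** y] meets I; its double entry [z] does not. *)
have := act_mulr kI (act_mull hI (mul_fix sb)).
rewrite -xh -yk xy => /esym/sym2_diag[+ _].
by rewrite actx1 // => zkh; apply: zN; rewrite -zkh; exact: invol_act.
Qed.

(** * The quotient X / <s> when s fixes everything outside I *)

Section AllFixed.
Hypothesis s_fix : forall a, ~ invol a -> act s a = a.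

(** If [t] is in I, then [y = act t x] and [x ** y] is [t] times [[e, s]]; otherwise [t ** y =
    [x, x]], and [tv_triple] makes [t] a double entry, fixed by [s]. *)
Lemma mul_moved x y t : ~ invol x -> ~ invol y -> sym2_in t (x ** y) ->
  x ** y = sym2 t (act s t).
Proof.
move=> xN yN txy; have [tI|tN] := pselect (invol t).
  by rewrite (invol_in tI txy) (act_mulr tI (mul_fix (s_fix xN))) actx1 // actC.
have := mul_fix_back (s_fix xN) (s_fix yN) txy.
by case/(tv_triple tN) => _; rewrite X_comm s_fix.
Qed.

Lemma mul_not_invol x y t : ~ invol x -> ~ invol y -> ~ invol t ->
  sym2_in t (x ** y) -> x ** y = sym2 t t.
Proof. by move=> xN yN tN txy; rewrite (mul_moved xN yN txy) s_fix. Qed.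

(** Equality in X / <s>, on which the product is well defined by [mul_act_eq_congr]. *)
Definition act_eq x y := y = x \/ y = act s x.

Lemma act_eq_trans x y z : act_eq x y -> act_eq y z -> act_eq x z.
Proof.
by move=> [->|->] [->|->]; rewrite /act_eq ?actK //; [left|right|right|left].
Qed.

Lemma mul_act_eq x y t r : sym2_in t (x ** y) -> sym2_in r (x ** y) -> act_eq t r.
Proof.
have [xI|xN] := pselect (invol x).
  by move=> /(in_act xI)-> /(in_act xI)->; left.
have [yI|yN] := pselect (invol y).
  by rewrite X_comm => /(in_act yI)-> /(in_act yI)->; left.
by move=> /(mul_moved xN yN)-> /sym2_in_pair.
Qed.

Lemma act_mul_in u x y t : invol u -> sym2_in t (act u x ** y) ->
  sym2_in (act u t) (x ** y).
Proof.
move=> uI [b /(act_mull uI)]; rewrite actK // => ->; by exists (act u b).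
Qed.

Lemma mul_act_eq_congr x x' y y' t r : act_eq x x' -> act_eq y y' ->
  sym2_in t (x ** y) -> sym2_in r (x' ** y') -> act_eq t r.
Proof.
have H a a' b p q : act_eq a a' -> sym2_in p (a ** b) -> sym2_in q (a' ** b) ->
    act_eq p q.
  move=> [->|->] pab; first exact: mul_act_eq.
  by move=> /(act_mul_in sI)/(mul_act_eq pab)[<-|/(can_inj (actK sI))->];
    [right; rewrite actK|left].
move=> xx' yy' txy rxy; have [q [q' qxy]] := sym2_surj (x' ** y).
have {q' qxy}qxy : sym2_in q (x' ** y) by exists q'.
apply: act_eq_trans (H _ _ _ _ _ xx' txy qxy) _.
by rewrite X_comm in qxy; rewrite X_comm in rxy; exact: H yy' qxy rxy.
Qed.

(* K represents a complement of I / <s> in X / <s>. *)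
Definition complement_set (K : set X) : Prop :=
  [/\ K e, forall c, K c -> invol c -> c = e,
      forall c d, K c -> K d -> exists2 t, K t & sym2_in t (c ** d) &
      forall a, exists u c, [/\ invol u, K c & a = act u c]].

(* complement_set without the element e *)
Let cap (K : set X) : Prop := (forall c, K c -> ~ invol c) /\
  forall c d, K c -> K d -> c <> d -> exists2 t, K t & c ** d = sym2 t t.

(** A maximal set for [cap] together with [e] will do. Leaving [e] out of [cap] lets the union of
    the empty chain qualify. *)
Lemma complement_setP : exists K, complement_set K.
Proof.
have [F FP|K [[KN KM] Kmax]] := @Zorn_bigcup X cap.
  move=> totF; split=> [c [A FA Ac]|c d [A FA Ac] [B FB Bd] cd].
    by have [+ _] := FP _ FA; apply.
  have [AB|BA] := totF _ _ FA FB.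
    have [_ /(_ c d (AB _ Ac) Bd cd)[t Bt ct]] := FP _ FB.
    by exists t => //; exists B.
  have [_ /(_ c d Ac (BA _ Bd) cd)[t At ct]] := FP _ FA.
  by exists t => //; exists A.
have span a : ~ invol a -> exists u c, [/\ invol u, K c & a = act u c].
  move=> aN; apply: contrapT => aK.
  (* [aK'] is the coset a K; if [a] is not spanned, adjoining [a] and [aK'] contradicts
     maximality. *)
  pose aK' t := exists2 c, K c & a ** c = sym2 t t.
  have mulaK c : K c -> exists t, [/\ ~ invol t, aK' t & a ** c = sym2 t t].
    move=> Kc; have [t [b ac]] := sym2_surj (a ** c); exists t.
    have tac : sym2_in t (a ** c) by exists b.
    have tN : ~ invol t.
      move=> tI; apply: aK; exists t, c; split=> //.
      by apply: invol_in; rewrite // X_comm.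
    have ac_t : a ** c = sym2 t t by apply: mul_not_invol => //; exact: KN.
    by split => //; exists c.
  apply: (Kmax (K `|` ([set a] `|` aK'))).
    split; first by left.
    move=> /(_ a) KaK; apply: aK; exists e, a; split.
    - exact: invol1.
    - by apply: KaK; right; left.
    - by rewrite act1.
  have aK'N t : aK' t -> ~ invol t.
    by move=> [c Kc ac_t]; have [] := tv_triple aN ac_t.
  split=> [c [Kc|[->|]]|] //; [exact: KN|exact: aK'N|].
  have aa' t : aK' t -> exists2 c, K c & a ** t = sym2 c c.
    move=> [c Kc ac_t]; exists c => //.
    by rewrite X_comm in ac_t; have [_] := tv_triple (KN _ Kc) ac_t.
  (* c (a d) = a (c d), which is [a] itself when [c = d]. *)
  have Ka' c t : K c -> aK' t -> exists2 r, a = r \/ aK' r & c ** t = sym2 r r.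
    move=> Kc [d Kd ad]; have [cd|/eqP cd] := eqVneq c d.
      subst d; exists a; first by left.
      by have [_] := tv_triple aN ad.
    have [f Kf cdf] := KM _ _ Kc Kd cd.
    have [r [rN a'r af]] := mulaK _ Kf.
    exists r; first by right.
    rewrite X_comm; apply/esym/sym2_sum_inj => k.
    rewrite X_comm in cdf.
    by have := tv_sumA4 k cdf ad; rewrite af sym2_sumE; lia.
  have a'a' t r : aK' t -> aK' r -> t <> r -> exists2 c, K c & t ** r = sym2 c c.
    move=> a't [d Kd ad] tr; have [c Kc atc] := aa' _ a't.
    have cd : c <> d.
      move=> cd; subst d; apply: tr.
      have [_] := tv_triple (aK'N _ a't) (etrans (X_comm _ _) atc).
      by rewrite ad => /sym2_diag[].
    have [f Kf cdf] := KM _ _ Kc Kd cd; exists f => //.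
    apply/esym/sym2_sum_inj => k; rewrite X_comm in atc.
    by have := tv_sumA4 k ad atc; rewrite cdf sym2_sumE; lia.
  move=> c d; case=> [Kc|[->|a'c]]; case=> [Kd|[->|a'd]] cd.
  - by have [t Kt] := KM _ _ Kc Kd cd; exists t => //; left.
  - have [t [_ a't]] := mulaK _ Kc; rewrite X_comm.
    by exists t => //; right; right.
  - have [r [<-|a'r]] := Ka' _ _ Kc a'd; first by exists a => //; right; left.
    by exists r => //; right; right.
  - have [t [_ a't]] := mulaK _ Kd.
    by exists t => //; right; right.
  - by case: cd.
  - by have [r Kr] := aa' _ a'd; exists r => //; left.
  - rewrite X_comm; have [r [<-|a'r]] := Ka' _ _ Kd a'c.
      by exists a => //; right; left.
    by exists r => //; right; right.
  - by have [r Kr] := aa' _ a'c; rewrite X_comm; exists r => //; left.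
  - by have [r Kr] := a'a' _ _ a'c a'd cd; exists r => //; left.
exists (e |` K); split=> [|c|c d|a].
- by left.
- by case=> // /KN.
- case=> [->|Kc]; first by exists d => //; rewrite tvmul1x; exists d.
  case=> [->|Kd]; first by exists c; [right|rewrite tvmulx1; exists c].
  have [<-|/eqP cd] := eqVneq c d.
    by exists e; [left|rewrite tvsqE; exists (tvsq c)].
  by have [t Kt ->] := KM _ _ Kc Kd cd; exists t; [right|exists t].
have [aI|/span[u [c [uI Kc ->]]]] := pselect (invol a).
  by exists a, e; split=> //; [left|rewrite actx1].
by exists u, c; split=> //; right.
Qed.

(** * The group law on the complement K *)

Section Complement.
Variable K : set X.
Hypothesis K_compl : complement_set K.

Lemma complement1 : K e.
Proof. by case: K_compl. Qed.

Lemma complement_invol c : K c -> invol c -> c = e.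
Proof. by case: K_compl => _ + _ _; apply. Qed.

Lemma complement_span a : exists u c, [/\ invol u, K c & a = act u c].
Proof. by case: K_compl => _ _ _; apply. Qed.

(** K meets I only in [e], while outside I the orbits of [s] are single points. *)
Lemma complement_act_eq c d : K c -> K d -> act_eq c d -> c = d.
Proof.
move=> Kc Kd [->//|dc]; have [cI|cN] := pselect (invol c).
  case: s_neq1; rewrite (complement_invol Kc cI) actx1 // in dc.
  by apply: complement_invol; rewrite // -dc.
by rewrite dc s_fix.
Qed.

(** The group law of V: for [c], [d] in K, the entry in K exists by closure and is unique by
    [mul_act_eq] and [complement_act_eq]. *)
Definition complement_mul c d : X := xget e [set t | K t /\ sym2_in t (c ** d)].

Lemma complement_mulP c d : K c -> K d ->
  K (complement_mul c d) /\ sym2_in (complement_mul c d) (c ** d).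
Proof.
move=> Kc Kd; have [_ _ KM _] := K_compl; have [t Kt tcd] := KM _ _ Kc Kd.
exact: (@xgetI _ e [set t | K t /\ sym2_in t (c ** d)] t).
Qed.

(** Both sides lie in K and agree modulo <s>, by associativity in X. *)
Lemma complement_mulA c d g : K c -> K d -> K g ->
  complement_mul c (complement_mul d g) = complement_mul (complement_mul c d) g.
Proof.
move=> Kc Kd Kg; have [Kcd cd] := complement_mulP Kc Kd.
have [Kdg dg] := complement_mulP Kd Kg.
have [Kl cl] := complement_mulP Kc Kdg; have [Kr cr] := complement_mulP Kcd Kg.
apply: complement_act_eq => //; have [t tcd] := tv_inA dg cl.
by move=> /(@mul_act_eq_congr t (complement_mul c d) g g); apply => //;
  [exact: mul_act_eq cd|left].
Qed.

Lemma complement_mul1 c : K c -> complement_mul e c = c.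
Proof.
move=> Kc; have [_] := complement_mulP complement1 Kc.
by rewrite tvmul1x => /sym2_in_pair[].
Qed.

Lemma complement_mulC c d : complement_mul c d = complement_mul d c.
Proof. by rewrite /complement_mul X_comm. Qed.

Lemma complement_mulxx c : K c -> complement_mul c c = e.
Proof.
move=> Kc; have [Kcc cc] := complement_mulP Kc Kc.
apply: complement_act_eq => //; first exact: complement1.
by apply: mul_act_eq cc _; rewrite tvsqE; exists (tvsq c).
Qed.

(** An entry in both K and I is [e], which would force [c = d]. *)
Lemma complement_mul_diag c d : K c -> K d -> c <> d ->
  c ** d = sym2 (complement_mul c d) (complement_mul c d).
Proof.
move=> Kc Kd cd; have [Kt tcd] := complement_mulP Kc Kd.
move: (complement_mul c d) => t in Kt tcd *.
have [cI|cN] := pselect (invol c).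
  by rewrite (in_act cI tcd) actE.
have [dI|dN] := pselect (invol d).
  by rewrite X_comm in tcd *; rewrite (in_act dI tcd) actE.
apply: mul_not_invol => // tI; apply: cd; move: tcd.
by rewrite (complement_invol Kt tI) => /tv_in1.
Qed.

(** The equation puts [act v u] in [c ** d]. If [c <> d], it is the double entry, which lies in K
    and in I and so is [e], forcing [c = d] after all. Then [act v u] is an entry of [c ** c], hence
    [e] modulo <s>. *)
Lemma complement_inj u v c d : invol u -> invol v -> K c -> K d ->
  act u c = act v d -> c = d /\ act_eq u v.
Proof.
move=> uI vI Kc Kd E.
have vuI : invol (act v u) by exact: invol_act.
have vucd : sym2_in (act v u) (c ** d).
  by apply/tv_in_rot; rewrite -[d](actK vI) -E actA //; exact: act_in.
have cd : c = d.
  apply: contrapT => cd; have := vucd; rewrite complement_mul_diag //.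
  have [Kt tcd] := complement_mulP Kc Kd => /sym2_in_pair H.
  have tE : complement_mul c d = act v u by case: H.
  rewrite tE in Kt tcd; move: tcd; rewrite (complement_invol Kt vuI).
  by move/tv_in1.
split => //; move: vucd; rewrite -cd => vucc.
have ecc : sym2_in e (c ** c) by rewrite tvsqE; exists (tvsq c).
rewrite /act_eq; have [] := mul_act_eq ecc vucc.
  by move=> /(congr1 (act v)); rewrite actK // actx1 // => <-; left.
move=> /(congr1 (act v)); rewrite actK // actx1 // => ->; right.
by rewrite actCA // actuu // actx1.
Qed.

End Complement.
End AllFixed.

End Double.

End Involutive.

(** * The topological model of a special two-valued group *)

Definition sym2_all (X : choiceType) (A : set X) : set (Sym2 X) :=
  [set z | forall t, sym2_in t z -> A t].

Lemma sym2_allE (X : choiceType) (A : set X) a b :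
  sym2_all A (sym2 a b) <-> A a /\ A b.
Proof.
split=> [H|[Aa Ab] t /sym2_in_pair[]-> //].
by split; apply: H; apply/sym2_in_pair; auto.
Qed.

(** The preimage under the quotient map is the product of [A] with itself. *)
Lemma sym2_all_open (X : topologicalType) (A : set X) :
  open A -> open (@sym2_all X A : set (Sym2 X)).
Proof.
move=> oA; rewrite /open /= /quotient_open.
rewrite (_ : _ @^-1` _ = fst @^-1` A `&` snd @^-1` A).
  by apply: openI; apply: open_comp => // p _; [exact: cvg_fst|exact: cvg_snd].
by apply/seteqP; split=> -[a b]; [case/sym2_allE|move=> ?; apply/sym2_allE].
Qed.

(** Pulling [sym2_all A] back along the doubled map gives the preimage of [A] under [h]. *)
Lemma sym2_diag_continuous (Z X : topologicalType) (h : Z -> X) :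
  continuous ((fun z => sym2 (h z) (h z)) : Z -> Sym2 X) -> continuous h.
Proof.
move=> /continuousP hc; apply/continuousP => A /sym2_all_open /hc.
rewrite (_ : _ @^-1` _ = h @^-1` A) //.
by apply/seteqP; split=> z /=; rewrite sym2_allE => // -[].
Qed.

(** If disjoint open [A], [B] separate [h x] from [x], then [h] has no fixed point in [B]
    intersected with the preimage of [A]. *)
Lemma open_moved (X : topologicalType) (h : X -> X) :
  hausdorff_space X -> continuous h -> open [set x | h x <> x].
Proof.
rewrite open_hausdorff => X_haus /continuousP hc; rewrite openE => x /eqP /= hx.
have [[A B] /= [Ahx Bx] [oA oB /eqP AB]] := X_haus _ _ hx.
rewrite /interior nbhsE; exists (B `&` h @^-1` A).
  by split; [apply: openI => //; exact: hc|split => //=; exact: set_mem].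
move=> y [By Ahy] /= hy; suff : (A `&` B) y by rewrite AB.
by split => //; rewrite -hy.
Qed.

Lemma initial_hausdorff (S : choiceType) (T : topologicalType) (h : S -> T) :
  injective h -> hausdorff_space T -> hausdorff_space (initial_topology h).
Proof.
move=> h_inj; rewrite !open_hausdorff => T_haus x y.
rewrite -(inj_eq h_inj) => /T_haus[[A B] /= [Ax By] [oA oB /eqP AB]].
exists (h @^-1` A, h @^-1` B) => /=; first by split; rewrite inE; exact: set_mem.
split; [by exists A|by exists B|].
by rewrite -preimage_setI AB preimage_set0 eqxx.
Qed.

Lemma F2_dim_ge2 (G : booleanGroupType) (a b : G) :
  a != 1 -> b != 1 -> a != b -> F2_dim_ge G 2.
Proof.
move=> a1 b1 ab; exists (fun i => if i == ord0 then a else b) => c.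
rewrite !big_ord_recl big_ord0 /= mulg1.
have F2E (i : 'F_2) : i = 0%R \/ i = 1%R.
  by case: i => -[|[|//]] ?; [left|right]; exact: val_inj.
have [c0|c0] := F2E (c ord0); have [c1|c1] := F2E (c (lift ord0 ord0));
    rewrite c0 c1 /= ?mul1g ?mulg1 => E.
- move=> i; have [->|->] // : i = ord0 \/ i = lift ord0 ord0.
  by case: i => -[|[|//]] ?; [left|right]; exact: val_inj.
- by case/eqP: b1; exact: E.
- by case/eqP: a1; exact: E.
- by case/eqP: ab; apply: (mulIg b); rewrite boolean_mulgg; exact: E.
Qed.

Lemma F2_dim_ge2_neq1 (G : booleanGroupType) :
  F2_dim_ge G 2 -> exists a : G, a != 1.
Proof.
move=> [v v_free]; exists (v ord0); apply/eqP => v1.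
have := v_free (fun i => if i == ord0 then 1%R else 0%R).
rewrite !big_ord_recl big_ord0 /= v1 !mulg1 => /(_ erefl ord0).
by rewrite eqxx.
Qed.

Lemma nonid_mul_neq1 (G : booleanGroupType) (v1 v2 : nonid G) :
  v1 != v2 -> val v1 * val v2 != 1.
Proof.
apply: contra_neq => v12; apply: val_inj; apply: (mulIg (val v2)).
by rewrite v12 boolean_mulgg.
Qed.

Section Model.
Variable X : topologicalTwoValuedGroupType.
Hypotheses (X_inv : tv_involutive X) (X_comm : tv_commutative X).
Hypothesis X_haus : hausdorff_space X.
Variable s : X.
Hypotheses (sI : invol s) (s_neq1 : s <> tvone).
Hypothesis s_fix : forall a : X, ~ invol a -> act s a = a.
Variable K : set X.
Hypothesis K_compl : complement_set K.

Local Notation e := (@tvone X).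
Local Notation "x ** y" := (tvmul x y) (at level 40).

(** * The topological Boolean group I *)

Definition invol_group : Type := set_type [set u : X | invol u].
HB.instance Definition _ := Topological.on invol_group.
HB.instance Definition _ := SubType.on invol_group.

Definition Invol (u : X) (uI : invol u) : invol_group := SigSub (mem_set uI).

Lemma invol_groupP (u : invol_group) : invol (val u).
Proof. exact: set_mem (valP u). Qed.

Definition invol_group_mul (u v : invol_group) : invol_group :=
  Invol (invol_act X_inv X_comm (invol_groupP u) (invol_groupP v)).

Lemma invol_group_mulA : associative invol_group_mul.
Proof.
by move=> u v w; apply: val_inj; rewrite /= (actA X_inv) //; exact: invol_groupP.
Qed.

Definition invol_group_one : invol_group := Invol (invol1 X_inv).

Lemma invol_group_mul1 : left_id invol_group_one invol_group_mul.
Proof. by move=> u; apply: val_inj; exact: act1. Qed.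

Lemma invol_group_mulr1 : right_id invol_group_one invol_group_mul.
Proof. by move=> u; apply: val_inj; apply: actx1 => //; exact: invol_groupP. Qed.

Lemma invol_group_mulxx u : invol_group_mul u u = invol_group_one.
Proof. by apply: val_inj; apply: actuu => //; exact: invol_groupP. Qed.

HB.instance Definition _ := isGroup.Build invol_group invol_group_mulA
  invol_group_mul1 invol_group_mulr1 invol_group_mulxx invol_group_mulxx.

Lemma invol_group_sq (u : invol_group) : u != 1 -> u ^+ 2 = 1.
Proof. by move=> _; exact: invol_group_mulxx. Qed.

HB.instance Definition _ := isBooleanGroup.Build invol_group invol_group_sq.

Lemma val_continuous : continuous (val : invol_group -> X).
Proof. exact: initial_continuous. Qed.

(** The product [val u ** x] is the double of [act (val u) x], so its continuity passes to the
    action. *)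
Lemma act_continuous : continuous (fun p : invol_group * X => act (val p.1) p.2).
Proof.
apply: sym2_diag_continuous.
rewrite (_ : (fun _ => _) = (fun p : invol_group * X => val p.1 ** p.2)); last first.
  by apply/funext => -[u x] /=; rewrite -actE //; exact: invol_groupP.
move=> p; apply: (@continuous_comp _ _ _ (fun p : invol_group * X => (val p.1, p.2))
  (fun p : X * X => p.1 ** p.2)); last exact: tvmul_continuous.
apply: pair_continuous_at; last exact: snd_continuous.
exact: (comp_continuous (@fst_continuous _ _) val_continuous).
Qed.

Lemma invol_group_mul_continuous :
  continuous (fun p : invol_group * invol_group => p.1 * p.2).
Proof.
apply/continuousP => _ [O oO <-].
suff /continuousP mul_cts : continuous (fun p : invol_group * invol_group =>
    act (val p.1) (val p.2)) by exact: mul_cts.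
move=> p; apply: (@continuous_comp _ _ _
  (fun p : invol_group * invol_group => (p.1, val p.2))
  (fun p => act (val p.1) p.2)); last exact: act_continuous.
apply: pair_continuous_at; first exact: fst_continuous.
exact: (comp_continuous (@snd_continuous _ _) val_continuous).
Qed.

Lemma invol_group_inv_continuous : continuous (fun u : invol_group => u^-1).
Proof. by move=> u; exact: cvg_id. Qed.

HB.instance Definition _ := isTopologicalGroup.Build invol_group
  invol_group_mul_continuous invol_group_inv_continuous.

Lemma invol_group_hausdorff : hausdorff_space invol_group.
Proof. by apply: initial_hausdorff => //; exact: val_inj. Qed.

(** * The Boolean group V carried by K *)

Definition compl_group : Type := set_type K.
HB.instance Definition _ := Choice.on compl_group.
HB.instance Definition _ := SubType.on compl_group.

Lemma compl_groupP (c : compl_group) : K (val c).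
Proof. exact: set_mem (valP c). Qed.

Definition compl_group_mul (c d : compl_group) : compl_group :=
  SigSub (mem_set
    (complement_mulP K_compl (compl_groupP c) (compl_groupP d)).1).

Definition compl_group_one : compl_group := SigSub (mem_set (complement1 K_compl)).

Lemma compl_group_mulA : associative compl_group_mul.
Proof.
move=> c d g; apply: val_inj => /=.
by apply: (complement_mulA X_inv X_comm sI) => //; exact: compl_groupP.
Qed.

Lemma compl_group_mulC : commutative compl_group_mul.
Proof. by move=> c d; apply: val_inj; exact: complement_mulC. Qed.

Lemma compl_group_mul1 : left_id compl_group_one compl_group_mul.
Proof. by move=> c; apply: val_inj; apply: complement_mul1 => //; exact: compl_groupP. Qed.

Lemma compl_group_mulr1 : right_id compl_group_one compl_group_mul.
Proof. by move=> c; rewrite compl_group_mulC compl_group_mul1. Qed.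

Lemma compl_group_mulxx c : compl_group_mul c c = compl_group_one.
Proof.
apply: val_inj.
by apply: (complement_mulxx X_inv X_comm sI) => //; exact: compl_groupP.
Qed.

HB.instance Definition _ := isGroup.Build compl_group compl_group_mulA
  compl_group_mul1 compl_group_mulr1 compl_group_mulxx compl_group_mulxx.

Lemma compl_group_sq (u : compl_group) : u != 1 -> u ^+ 2 = 1.
Proof. by move=> _; exact: compl_group_mulxx. Qed.

HB.instance Definition _ := isBooleanGroup.Build compl_group compl_group_sq.

(** * The comparison map from Y to X *)

Let S : invol_group := Invol sI.
Local Notation Y := (@Yspace compl_group invol_group S).

Lemma compl_group_neq1 (v : nonid compl_group) : ~ invol (val (val v)).
Proof.
move=> vI; have /eqP := valP v; apply; apply: val_inj.
by apply: (complement_invol K_compl) => //; exact: compl_groupP.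
Qed.

Lemma act_valE (u : invol_group) x : val u ** x = sym2 (act (val u) x) (act (val u) x).
Proof. by apply: actE => //; exact: invol_groupP. Qed.

Lemma act_valA (u v : invol_group) x :
  act (val u) (act (val v) x) = act (val (u * v)) x.
Proof. by apply: actA => //; exact: invol_groupP. Qed.

Lemma act_val_mulr (u : invol_group) x y a b : x ** y = sym2 a b ->
  x ** act (val u) y = sym2 (act (val u) a) (act (val u) b).
Proof. by move=> xy; apply: act_mulr => //; exact: invol_groupP. Qed.

Lemma act_val_mull (u : invol_group) x y a b : x ** y = sym2 a b ->
  act (val u) x ** y = sym2 (act (val u) a) (act (val u) b).
Proof. by move=> xy; apply: act_mull => //; exact: invol_groupP. Qed.

Lemma act_val1 (u : invol_group) : act (val u) e = val u.
Proof. by apply: actx1 => //; exact: invol_groupP. Qed.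

Lemma act_val_fix (v : nonid compl_group) : act s (val (val v)) = val (val v).
Proof. by apply: s_fix; exact: compl_group_neq1. Qed.

Lemma mul_compl_diag (v : nonid compl_group) : val (val v) ** val (val v) = sym2 e s.
Proof. by apply: mul_fix => //; exact: act_val_fix. Qed.

(** The representative is [u] or [S * u], and [s] fixes the elements of K outside I. *)
Lemma act_val_repr (u : invol_group) (v : nonid compl_group) :
  act (val (coset_repr (coset_proj S u))) (val (val v)) = act (val u) (val (val v)).
Proof.
have /coset_projP[->//|->] : coset_proj S u = coset_proj S (coset_repr (coset_proj S u)).
  by rewrite coset_projK.
by rewrite boolean_mulgC -act_valA act_val_fix.
Qed.

Definition model_map (y : Y) : X :=
  match y with
  | inl u => val u
  | inr (v, w) => act (val (coset_repr w)) (val (val v))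
  end.

Lemma model_map_inr u v :
  model_map (inr (v, coset_proj S u)) = act (val u) (val (val v)).
Proof. exact: act_val_repr. Qed.

Lemma model_map_not_invol v w : ~ invol (model_map (inr (v, w))).
Proof.
rewrite -[w]coset_projK model_map_inr; apply: (act_fix_not_invol X_inv X_comm sI s_neq1).
apply: (act_fix_act X_inv X_comm sI); first exact: invol_groupP.
exact: act_val_fix.
Qed.

Lemma model_map_inj : injective model_map.
Proof.
move=> [u|[v w]] [u'|[v' w']] E.
- by congr inl; exact: val_inj.
- by case: (@model_map_not_invol v' w'); rewrite -E; exact: invol_groupP.
- by case: (@model_map_not_invol v w); rewrite E; exact: invol_groupP.
move: E; rewrite -[w]coset_projK -[w']coset_projK !model_map_inr => E.
have [vv ww] := complement_inj X_inv X_comm sI s_neq1 s_fix K_compl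
  (invol_groupP _) (invol_groupP _) (compl_groupP _) (compl_groupP _) E.
congr (inr (_, _)); first by do 2!apply: val_inj.
by apply/coset_projP; case: ww => ww; [left|right]; exact: val_inj.
Qed.

Lemma model_map_surj x : exists y, model_map y = x.
Proof.
have [u [c [uI Kc ->]]] := complement_span K_compl x.
pose k : compl_group := SigSub (mem_set Kc).
have [c1|c1] := eqVneq k 1.
  have ce : c = e := congr1 val c1.
  by exists (inl (Invol uI)); rewrite ce (actx1 X_inv).
pose v : nonid compl_group := exist (fun v : compl_group => v != 1) k c1.
by exists (inr (v, coset_proj S (Invol uI))); rewrite model_map_inr.
Qed.

Lemma model_map_morph y1 y2 a b : tvmul y1 y2 = sym2 a b ->
  model_map y1 ** model_map y2 = sym2 (model_map a) (model_map b).
Proof.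
(* The product determines [a] and [b] up to order, so one description of it suffices. *)
suff [c [d [-> ->]]] : exists c d, tvmul y1 y2 = sym2 c d /\
    model_map y1 ** model_map y2 = sym2 (model_map c) (model_map d).
  by move=> /sym2_eq[] [-> ->] //; rewrite sym2C.
have mixed u v w : model_map (inl u) ** model_map (inr (v, w)) =
    sym2 (model_map (inr (v, coset_mul (coset_proj S u) w)))
         (model_map (inr (v, coset_mul (coset_proj S u) w))).
  rewrite -[w]coset_projK coset_projM !model_map_inr /=.
  by rewrite act_valE act_valA.
case: y1 y2 => [u1|[v1 w1]] [u2|[v2 w2]].
- exists (inl (u1 * u2)), (inl (u1 * u2)); split => //=.
  exact: act_valE.
- by do 2!eexists; split; last exact: mixed.
- by do 2!eexists; split; last by rewrite X_comm; exact: mixed.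
rewrite -[w1]coset_projK -[w2]coset_projK !model_map_inr.
set u1 := coset_repr w1; set u2 := coset_repr w2.
have mulE (p q : X) : val (val v1) ** val (val v2) = sym2 p q ->
    act (val u1) (val (val v1)) ** act (val u2) (val (val v2)) =
    sym2 (act (val (u1 * u2)) p) (act (val (u1 * u2)) q).
  by move=> /(act_val_mulr u2)/(act_val_mull u1); rewrite !act_valA.
have -> (p q : Y) : tvmul p q = Ymul p q by [].
rewrite /= coset_projM; move: mulE; have [<-|v12] := eqVneq v1 v2 => mulE.
  do 2!eexists; split; first reflexivity.
  rewrite (mulE e s) ?mul_compl_diag // act_val1.
  have -> : act (val (u1 * u2)) s = val (S * (u1 * u2)) by rewrite [S * _]boolean_mulgC.
  (* The representative of the coset may exchange the two entries. *)
  have /coset_projP[-> //|->] : coset_proj S (u1 * u2) =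
      coset_proj S (coset_repr (coset_proj S (u1 * u2))).
    by rewrite coset_projK.
  by rewrite [S * (S * _)]mulgA boolean_mulgg mul1g sym2C.
do 2!eexists; split; first reflexivity.
rewrite model_map_inr val_insubd nonid_mul_neq1 //; apply: mulE.
apply: (complement_mul_diag X_inv X_comm sI s_neq1 s_fix K_compl) => //.
- exact: compl_groupP.
- exact: compl_groupP.
- by move=> /val_inj/val_inj/eqP; rewrite (negPf v12).
Qed.

Lemma invol_open : open [set x : X | invol x].
Proof.
rewrite (_ : [set _ | _] = [set x | act s x <> x]).
  apply: open_moved => // x; pose f (z : X) : invol_group * X := (S, z).
  apply: (@continuous_comp _ _ _ f (fun p => act (val p.1) p.2));
    last exact: act_continuous.
  by apply: pair_continuous_at; [exact: cst_continuous|exact: cvg_id].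
apply/seteqP; split=> x /=.
  by move=> xI /(act_fix_not_invol X_inv X_comm sI s_neq1).
by move=> sx; apply: contrapT => /s_fix.
Qed.

Lemma val_open (A : set invol_group) : open A -> open (val @` A).
Proof.
case=> O oO <-; rewrite (_ : _ @` _ = O `&` [set x : X | invol x]).
  by apply: openI => //; exact: invol_open.
apply/seteqP; split=> [_ [u Ou <-]|x [Ox xI]]; first by split => //; exact: invol_groupP.
by exists (Invol xI).
Qed.

Lemma model_map_continuous : continuous model_map.
Proof.
apply/continuousP => O oO; split.
  by move/continuousP: val_continuous; apply.
rewrite openE => -[v w] Ovw; rewrite /interior.
pose h (w : coset_space S) : X := act (val (coset_repr w)) (val (val v)).
have h_cts : continuous (h : coset_space S -> X).
  apply/(quotient_continuous (Q0 := {eq_quot coset_equiv S})).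
  rewrite (_ : _ \o _ = fun u => act (val u) (val (val v))).
    move=> u; pose f (z : invol_group) : invol_group * X := (z, val (val v)).
    apply: (@continuous_comp _ _ _ f (fun p => act (val p.1) p.2));
      last exact: act_continuous.
    by apply: pair_continuous_at; [exact: cvg_id|exact: cst_continuous].
  by apply/funext => u; exact: act_val_repr.
exists ([set v], h @^-1` O); last by move=> [v' w'] [/= -> ].
split; first exact: discrete_set1.
apply: h_cts; apply: open_nbhs_nbhs; split; [exact: oO|exact: Ovw].
Qed.

Lemma model_map_open (O : set Y) : open O -> open (model_map @` O).
Proof.
move=> [oO1 oO2].
(* [A v] is the lift to I of the slice of [O] over [v], and is stable under [S]. The product of
   [act u v] with [v] is [u] times [[e, s]], so it lies inside [A v] exactly when [u] does; by
   rotation all points of [B v] have this form, so [B v] is the image of the slice. *)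
pose A v := coset_proj S @^-1` [set w | O (inr (v, w))].
pose B v := [set x | sym2_all (val @` A v) (x ** val (val v))].
have -> : model_map @` O = val @` (inl @^-1` O) `|` \bigcup_v B v.
  apply/seteqP; split=> [_ [[u|[v w]] Oy <-]|x [[u Ou <-]|[v _]]].
  - by left; exists u.
  - right; exists v => //; rewrite /B /=.
    rewrite (act_val_mull _ (mul_compl_diag v)); apply/sym2_allE.
    rewrite act_val1; split.
      by exists (coset_repr w) => //; rewrite /A /= coset_projK.
    exists (coset_repr w * S) => //; rewrite /A /=.
    suff -> : coset_proj S (coset_repr w * S) = w by [].
    rewrite -[RHS]coset_projK; apply/esym/coset_projP; right.
    by rewrite boolean_mulgC.
  - by exists (inl u).
  - have [t [t' xv]] := sym2_surj (x ** val (val v)).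
    have txv : sym2_in t (val (val v) ** x) by rewrite X_comm; exists t'.
    rewrite /B /= xv => /sym2_allE[[u Au ut] _]; rewrite -ut in txv.
    exists (inr (v, coset_proj S u)) => //; rewrite model_map_inr.
    by rewrite (invol_in X_inv (invol_groupP u) txv).
apply: openU; first exact: val_open.
apply: bigcup_open => v _; rewrite /B.
have oA : open (A v).
  rewrite /A; move/continuousP: (@coset_proj_continuous _ S); apply.
  have /continuousP : continuous
      ((fun w => (v, w)) : coset_space S -> nonid compl_group * coset_space S).
    by move=> w; apply: pair_continuous_at; [exact: cst_continuous|exact: cvg_id].
  by move=> /(_ _ oO2).
have /continuousP : continuous ((fun x : X => x ** val (val v)) : X -> Sym2 X).
  move=> x; pose f (z : X) : X * X := (z, val (val v)).
  apply: (@continuous_comp _ _ _ f (fun p : X * X => p.1 ** p.2));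
    last exact: tvmul_continuous.
  by apply: pair_continuous_at; [exact: cvg_id|exact: cst_continuous].
by apply; apply: sym2_all_open; exact: val_open.
Qed.

Lemma model_isomorphic : tv_isomorphic X Y.
Proof.
have /choice[f fK] := model_map_surj.
have gK : cancel model_map f by move=> y; apply: model_map_inj; rewrite fK.
exists f, model_map; split=> //.
- apply/continuousP => O /model_map_open.
  rewrite (_ : model_map @` O = f @^-1` O) //.
  apply/seteqP; split=> [_ [y Oy <-]|x Ofx] /=; first by rewrite gK.
  by exists (f x).
- exact: model_map_continuous.
move=> x y z1 z2 xy; have [a [b fxy]] := sym2_surj (tvmul (f x) (f y)).
have := model_map_morph fxy; rewrite !fK xy fxy => /sym2_eq[] [-> ->]; rewrite !gK //.
by rewrite sym2C.
Qed.

(** The components of [x] and [y] in K are distinct and nontrivial: were they equal, [x ** y] would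
    meet I, but its double entry [z] lies outside. *)
Lemma compl_group_dim (x y z : X) : ~ invol x -> ~ invol y -> x ** y = sym2 z z ->
  F2_dim_ge compl_group 2.
Proof.
move=> xN yN xy; have [zN yz] := tv_triple X_inv xN xy.
have [u [c [uI Kc xE]]] := complement_span K_compl x.
have [v [d [vI Kd yE]]] := complement_span K_compl y.
have neq1 t (Kt : K t) : t <> e -> (SigSub (mem_set Kt) : compl_group) != 1.
  by move=> t1; apply/eqP => /(congr1 val).
pose k t (Kt : K t) : compl_group := SigSub (mem_set Kt).
apply: (@F2_dim_ge2 _ (k c Kc) (k d Kd)).
- by apply: neq1 => c1; apply: xN; rewrite xE c1 actx1.
- by apply: neq1 => d1; apply: yN; rewrite yE d1 actx1.
apply/eqP => /(congr1 val) /= cd; rewrite -{}cd in yE.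
apply: zN; have := act_mulr X_inv X_comm vI (act_mull X_inv uI (tvsqE X_inv c)).
rewrite -xE -yE xy => /esym/sym2_diag[<- _].
by rewrite actx1 //; exact: invol_act.
Qed.

Lemma model_exists (x y z : X) : ~ invol x -> ~ invol y -> x ** y = sym2 z z ->
  exists (V : booleanGroupType) (U : topologicalBooleanGroupType) (s : U),
    [/\ F2_dim_ge V 2, hausdorff_space U, s != 1 &
        tv_isomorphic X (Yspace V s)].
Proof.
move=> xN yN xy; exists compl_group, invol_group, S; split.
- exact: compl_group_dim xN yN xy.
- exact: invol_group_hausdorff.
- by apply/eqP => /(congr1 val).
- exact: model_isomorphic.
Qed.

End Model.

(** * From orders of elements to the model *)

Lemma tvord_gt2_not_invol (X : twoValuedGroupType) (x : X) :
  tv_involutive X -> tvord_gt 2 x -> ~ invol x.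
Proof.
move=> X_inv x_ord xI; have xx := invol_mul X_inv xI.
(* The alternating sequence e, x, e, x, ... is a power sequence, so [tvpow x] is not the default
   value of [xget]. *)
pose p k := if odd k then x else tvone : X.
have : tv_powers x (tvpow x).
  apply: (@xgetI _ _ (tv_powers x) p); split=> // -[//|k] _.
  by rewrite /p /=; case: (odd k); rewrite /= ?xx ?tvmul1x ?tvmulx1.
case=> p0 p1 /(_ 1%N isT)[]; rewrite p1 p0 xx => /esym/sym2_diag[_ p2] _.
have ex2 : (0 < 2)%N && (tvpow x 2 == tvone) by rewrite p2 eqxx.
move: x_ord; rewrite /tvord_gt /tvord; case: pselect => [ex_k|[]]; last by exists 2%N.
by case: ex_minnP => m _ /(_ _ ex2); rewrite leqNgt => /negPf->.
Qed.

Lemma special_isomorphic (X : topologicalTwoValuedGroupType) :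
  tv_involutive X -> tv_commutative X -> tv_special X -> hausdorff_space X ->
  exists (V : booleanGroupType) (U : topologicalBooleanGroupType) (s : U),
    [/\ F2_dim_ge V 2, hausdorff_space U, s != 1 &
        tv_isomorphic X (Yspace V s)].
Proof.
move=> X_inv X_comm [x [y [/(tvord_gt2_not_invol X_inv) xN]]] + [z xy] X_haus.
move=> /(tvord_gt2_not_invol X_inv) yN.
have [sI _ _] := tv_double_sq X_inv X_comm xN yN xy.
set s := tvsq x in sI.
(* [invol x] unfolds to [tvsq x = tvone]. *)
have s1 : s <> tvone := xN.
have s_fix a : ~ invol a -> act s a = a.
  exact: (double_fix X_inv X_comm sI s1 xN yN xy (erefl s)).
have [K K_compl] := complement_setP X_inv X_comm sI s1 s_fix.
exact: (model_exists X_inv X_comm X_haus sI s1 s_fix K_compl xN yN xy).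
Qed.

(** * Isomorphisms between the models *)

Section InverseMorphism.
Variables (X Z : twoValuedGroupType) (F : X -> Z).
Hypothesis F_morph : forall x y z1 z2, tvmul x y = sym2 z1 z2 ->
  tvmul (F x) (F y) = sym2 (F z1) (F z2).

Lemma tv_morph_in x y t : sym2_in t (tvmul x y) -> sym2_in (F t) (tvmul (F x) (F y)).
Proof. by move=> [b /F_morph->]; exists (F b). Qed.

(** The image of [e] squares to a double of itself, and every square contains [e]. *)
Lemma tv_morph1 : tv_involutive Z -> F tvone = tvone.
Proof.
move=> Z_inv; have := F_morph (tvmul1x tvone).
by rewrite (tvsqE Z_inv) => /sym2_diag[].
Qed.

Lemma tv_morph_inv G : cancel F G -> cancel G F ->
  forall x y z1 z2, tvmul x y = sym2 z1 z2 -> tvmul (G x) (G y) = sym2 (G z1) (G z2).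
Proof.
move=> FK GK x y z1 z2 xy; have [a [b Gxy]] := sym2_surj (tvmul (G x) (G y)).
have := F_morph Gxy; rewrite !GK xy Gxy => /sym2_eq[] [-> ->]; rewrite !FK //.
exact: sym2C.
Qed.

End InverseMorphism.

(** * The projection of Y to V *)

Section Yclass.
Variables (V : booleanGroupType) (U : topologicalBooleanGroupType) (s : U).
Local Notation Y := (@Yspace V U s).

Lemma Y_involutive : tv_involutive Y.
Proof. by []. Qed.

(* the projection of Y to V = Y / U, and a section of it *)
Definition Yclass (y : Y) : V := if y is inr (v, _) then val v else 1.

Definition Ylift (v : V) : Y :=
  if insub v is Some v' then inr (v' : nonid V, coset_proj s 1) else inl 1.

Lemma YliftK : cancel Ylift Yclass.
Proof. by move=> v; rewrite /Ylift; case: insubP => //= /negPn/eqP. Qed.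

Lemma Yclass_inl (y : Y) : Yclass y = 1 -> exists u, y = inl u.
Proof.
by case: y => [u _|[v w] /= /eqP v1]; [exists u|case/negP: (valP v)].
Qed.

Lemma Yclass_mul (x y t : Y) : sym2_in t (tvmul x y) -> Yclass t = Yclass x * Yclass y.
Proof.
case: x y => [u|[v w]] [u'|[v' w']]; rewrite /tvmul /=.
- by move=> /sym2_in_pair[]->; rewrite mulg1.
- by move=> /sym2_in_pair[]->; rewrite mul1g.
- by move=> /sym2_in_pair[]->; rewrite mulg1.
case: eqVneq => [<-|vv'] /sym2_in_pair[]->; rewrite ?boolean_mulgg //=.
  by rewrite val_insubd nonid_mul_neq1.
by rewrite val_insubd nonid_mul_neq1.
Qed.

(** The fibres of [Yclass] are orbits of U, so a morphism that preserves U acts on classes. *)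
Lemma Yclass_eq (x y : Y) : Yclass x = Yclass y ->
  exists u, sym2_in x (tvmul (inl u : Y) y).
Proof.
case: x y => [u|[v w]] [u'|[v' w']] /=.
- move=> _; exists (u * u'); apply/sym2_in_pair; left.
  by rewrite -mulgA boolean_mulgg mulg1.
- by move/eqP; rewrite eq_sym (negPf (valP v')).
- by move/eqP; rewrite (negPf (valP v)).
move=> /val_inj->; exists (coset_repr w * coset_repr w').
apply/sym2_in_pair; left; congr (inr (_, _)).
rewrite -{2}[w']coset_projK coset_projM -mulgA boolean_mulgg mulg1.
by rewrite coset_projK.
Qed.

Lemma Ysq (y : Y) : Yclass y != 1 -> tvmul y y = sym2 (inl 1) (inl s).
Proof.
case: y => [u|[v w]] /=; [by rewrite eqxx|move=> _].
rewrite /tvmul /= eqxx -[w]coset_projK coset_projM boolean_mulgg.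
have /coset_projP[->|->] : coset_proj s 1 = coset_proj s (coset_repr (coset_proj s 1)).
- by rewrite coset_projK.
- by rewrite mulg1.
by rewrite mulgA boolean_mulgg mul1g sym2C mulg1.
Qed.

Lemma Ymul_inl (u1 u2 : U) :
  tvmul (inl u1 : Y) (inl u2 : Y) = sym2 (inl (u1 * u2)) (inl (u1 * u2)).
Proof. by []. Qed.

End Yclass.

(** * Maps of U and V induced by a morphism of models *)

Section Restriction.
Variables (V1 V2 : booleanGroupType) (U1 U2 : topologicalBooleanGroupType).
Variables (s1 : U1) (s2 : U2) (F : Yspace V1 s1 -> Yspace V2 s2).
Hypotheses (s2_neq1 : s2 != 1) (F_cts : continuous F).
Hypothesis F_morph : forall x y z1 z2, tvmul x y = sym2 z1 z2 ->
  tvmul (F x) (F y) = sym2 (F z1) (F z2).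

(** Elements of U square to [[e, e]] and the others to [[e, s2]], so [F] maps U1 into U2. *)
Lemma Yrestrict : exists f : U1 -> U2,
  [/\ continuous f, {morph f : x y / x * y} & forall u, F (inl u) = inl (f u)].
Proof.
have F1 : F (inl 1) = inl 1 := tv_morph1 F_morph (@Y_involutive _ _ _).
have Finl u : exists u', F (inl u) = inl u'.
  apply: Yclass_inl; apply: contrapT => /eqP/Ysq E.
  have := F_morph (Ymul_inl V1 s1 u u); rewrite boolean_mulgg E F1.
  by move=> /sym2_diag[_ [s21]]; case/eqP: s2_neq1.
have /choice[f Ff] := Finl; exists f; split=> //.
  apply/continuousP => O oO.
  rewrite (_ : _ @^-1` _ = (fun u => F (inl u)) @^-1` (inl @` O)).
    have inl_cts := @inl_continuous U1 (nonid V1 * coset_space s1)%type.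
    move/continuousP: (comp_continuous inl_cts F_cts); apply; split.
      rewrite (_ : _ @^-1` _ = O) //; apply/seteqP.
      by split=> [u [u' Ou [<-]]|u Ou] //; exists u.
    rewrite (_ : _ @^-1` _ = set0); first exact: open0.
    by rewrite -subset0 => w [].
  apply/seteqP; split=> u /=; first by move=> Ou; exists (f u).
  by rewrite Ff => -[u' Ou [<-]].
move=> u v; have := F_morph (Ymul_inl V1 s1 u v).
by rewrite !Ff Ymul_inl => /sym2_diag[[]].
Qed.

Lemma Yclass_image x y : Yclass x = Yclass y -> Yclass (F x) = Yclass (F y).
Proof.
have [f [_ _ Ff]] := Yrestrict.
by move=> /Yclass_eq[u /(tv_morph_in F_morph)/Yclass_mul]; rewrite Ff mul1g.
Qed.

Definition Yclass_map (v : V1) : V2 := Yclass (F (Ylift s1 v)).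

Lemma Yclass_mapE x : Yclass (F x) = Yclass_map (Yclass x).
Proof. by apply: Yclass_image; rewrite YliftK. Qed.

Lemma Yclass_mapM : {morph Yclass_map : x y / x * y}.
Proof.
move=> v1 v2; have [t [t' v12]] := sym2_surj (tvmul (Ylift s1 v1) (Ylift s1 v2)).
have t_in : sym2_in t (tvmul (Ylift s1 v1) (Ylift s1 v2)) by exists t'.
rewrite -(Yclass_mul (tv_morph_in F_morph t_in)) Yclass_mapE.
by rewrite (Yclass_mul t_in) !YliftK.
Qed.

End Restriction.

(** * Morphisms of models built from maps of V and U *)

Section Extension.
Variables (V1 V2 : booleanGroupType) (U1 U2 : topologicalBooleanGroupType).
Variables (s1 : U1) (s2 : U2) (h : V1 -> V2) (f : U1 -> U2).
Hypotheses (h_inj : injective h) (hM : {morph h : x y / x * y}).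
Hypotheses (f_cts : continuous f) (fM : {morph f : x y / x * y}) (fs : f s1 = s2).

Lemma nonid_map_subproof (v : nonid V1) : h (val v) != 1.
Proof.
have h1 : h 1 = 1 by apply: (mulgI (h 1)); rewrite -hM !mulg1.
by rewrite -h1 (inj_eq h_inj); exact: valP v.
Qed.

Definition nonid_map (v : nonid V1) : nonid V2 :=
  exist (fun v : V2 => v != 1) (h (val v)) (nonid_map_subproof v).

Definition coset_map (w : coset_space s1) : coset_space s2 :=
  coset_proj s2 (f (coset_repr w)).

(** The choice of representative is harmless because [f] sends [s1] to [s2]. *)
Lemma coset_mapE u : coset_map (coset_proj s1 u) = coset_proj s2 (f u).
Proof.
have /coset_projP[E|E] : coset_proj s1 u = coset_proj s1 (coset_repr (coset_proj s1 u)).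
- by rewrite coset_projK.
- by rewrite /coset_map E.
by apply/esym/coset_projP; right; rewrite E fM fs.
Qed.

Definition Yextend (y : Yspace V1 s1) : Yspace V2 s2 :=
  match y with
  | inl u => inl (f u)
  | inr (v, w) => inr (nonid_map v, coset_map w)
  end.

Lemma coset_mapM w1 w2 :
  coset_mul (coset_map w1) (coset_map w2) = coset_map (coset_mul w1 w2).
Proof.
by rewrite -[w1]coset_projK -[w2]coset_projK coset_projM !coset_mapE coset_projM fM.
Qed.

Lemma coset_map_continuous : continuous coset_map.
Proof.
apply/(quotient_continuous (Q0 := {eq_quot coset_equiv s1})).
rewrite (_ : _ \o _ = fun u => coset_proj s2 (f u)).
  exact: (comp_continuous f_cts (@coset_proj_continuous _ s2)).
by apply/funext => u; exact: coset_mapE.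
Qed.

Lemma Yextend_continuous : continuous Yextend.
Proof.
apply/continuousP => O [oO1 oO2]; split.
  by move/continuousP: f_cts => /(_ _ oO1).
suff /continuousP cts : continuous (fun p : nonid V1 * coset_space s1 =>
    (nonid_map p.1, coset_map p.2)).
  rewrite (_ : _ @^-1` _ = (fun p : nonid V1 * coset_space s1 =>
    (nonid_map p.1, coset_map p.2)) @^-1` (inr @^-1` O)); first exact: cts.
  by apply/seteqP; split=> -[v w].
move=> p; apply: (@pair_continuous_at _ _ _
  (fun p : nonid V1 * coset_space s1 => nonid_map p.1) (fun p => coset_map p.2)).
  apply: (comp_continuous (@fst_continuous _ _)).
  by apply/continuousP => A _; exact: discrete_open.
exact: (comp_continuous (@snd_continuous _ _) coset_map_continuous).
Qed.

Lemma Yextend_morph x y z1 z2 : tvmul x y = sym2 z1 z2 ->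
  tvmul (Yextend x) (Yextend y) = sym2 (Yextend z1) (Yextend z2).
Proof.
suff [c [d [-> ->]]] : exists c d, tvmul x y = sym2 c d /\
    tvmul (Yextend x) (Yextend y) = sym2 (Yextend c) (Yextend d).
  by move=> /sym2_eq[] [-> ->] //; rewrite sym2C.
case: x y => [u|[v w]] [u'|[v' w']]; rewrite /tvmul /=.
- by do 2!eexists; split; first reflexivity; rewrite /= fM.
- by do 2!eexists; split; first reflexivity;
    rewrite /= -coset_mapM coset_mapE.
- by do 2!eexists; split; first reflexivity;
    rewrite /= -coset_mapM coset_mapE.
rewrite coset_mapM; have -> : (nonid_map v == nonid_map v') = (v == v').
  by rewrite -(inj_eq val_inj) /= (inj_eq h_inj) (inj_eq val_inj).
have [_|vv'] := eqVneq v v'; do 2!eexists; split; try reflexivity; rewrite /=.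
  rewrite fM fs; set r := coset_repr (coset_mul w w').
  (* The chosen representatives may differ by [s2], which only exchanges the entries. *)
  have /coset_projP[->|->] : coset_proj s2 (f r) =
      coset_proj s2 (coset_repr (coset_map (coset_mul w w'))).
  - by rewrite coset_projK.
  - by [].
  by rewrite mulgA boolean_mulgg mul1g sym2C.
(* Neither [insubd] falls back to its default, since [v] and [v'] differ. *)
suff -> : insubd (nonid_map v) (h (val v) * h (val v')) =
    nonid_map (insubd v (val v * val v')) by [].
apply: val_inj; rewrite /= !val_insubd -hM /=.
rewrite nonid_mul_neq1 //.
have := nonid_map_subproof (insubd v (val v * val v')).
by rewrite val_insubd nonid_mul_neq1 // => ->.
Qed.

End Extension.

Lemma Yextend_can (V1 V2 : booleanGroupType) (U1 U2 : topologicalBooleanGroupType)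
    (s1 : U1) (s2 : U2) (h : V1 -> V2) (k : V2 -> V1) (f : U1 -> U2) (g : U2 -> U1)
    (h_inj : injective h) (hM : {morph h : x y / x * y})
    (k_inj : injective k) (kM : {morph k : x y / x * y}) :
  {morph g : x y / x * y} -> g s2 = s1 -> cancel h k -> cancel f g ->
  cancel (@Yextend V1 V2 U1 U2 s1 s2 h f h_inj hM) (@Yextend V2 V1 U2 U1 s2 s1 k g k_inj kM).
Proof.
move=> gM gs hK fK [u|[v w]] /=; first by rewrite fK.
congr (inr (_, _)); first by apply: val_inj; rewrite /= hK.
by rewrite {2}/coset_map coset_mapE // fK coset_projK.
Qed.

Lemma Yspace_isomorphicP (V1 V2 : booleanGroupType)
    (U1 U2 : topologicalBooleanGroupType) (s1 : U1) (s2 : U2) :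
  F2_dim_ge V1 2 -> s1 != 1 -> s2 != 1 ->
  tv_isomorphic (Yspace V1 s1) (Yspace V2 s2) <->
  group_isomorphic V1 V2 /\
  exists f : U1 -> U2, topological_group_iso f /\ f s1 = s2.
Proof.
move=> /F2_dim_ge2_neq1[v v1] s1N s2N; split; last first.
  move=> [[h [h_bij hM]] [f [[g [f_cts g_cts fK gK fM]] fs]]].
  have [k hK kK] := h_bij.
  have gM : {morph g : x y / x * y}.
    by move=> x y; apply: (can_inj fK); rewrite fM !gK.
  have kM : {morph k : x y / x * y}.
    by move=> x y; apply: (can_inj hK); rewrite hM !kK.
  have gs : g s2 = s1 by rewrite -fs fK.
  have h_inj := can_inj hK; have k_inj := can_inj kK.
  exists (@Yextend _ _ _ _ s1 s2 h f h_inj hM),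
    (@Yextend _ _ _ _ s2 s1 k g k_inj kM).
  split.
  - exact: Yextend_continuous.
  - exact: Yextend_continuous.
  - exact: Yextend_can.
  - exact: Yextend_can.
  - exact: Yextend_morph.
move=> [F [G [F_cts G_cts FK GK F_morph]]].
have G_morph := tv_morph_inv F_morph FK GK.
have [f [f_cts fM Ff]] := Yrestrict s2N F_cts F_morph.
have [g [g_cts gM Gg]] := Yrestrict s1N G_cts G_morph.
split.
  exists (Yclass_map F); split; last exact: Yclass_mapM s2N F_cts F_morph.
  exists (Yclass_map G) => w.
    by rewrite -(Yclass_mapE s1N G_cts G_morph) FK YliftK.
  by rewrite -(Yclass_mapE s2N F_cts F_morph) GK YliftK.
exists f; split.
  exists g; split=> // u.
    by have := FK (inl u); rewrite Ff Gg => -[].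
  by have := GK (inl u); rewrite Gg Ff => -[].
(* An element outside U1 has square [[e, s1]]; its image lies outside U2 and has square [[e, s2]],
   which gives [f s1 = s2]. *)
have c1 : Yclass (Ylift s1 v) != 1 by rewrite YliftK.
have c2 : Yclass (F (Ylift s1 v)) != 1.
  apply/eqP => /Yclass_inl[u Fu]; have := FK (Ylift s1 v).
  by rewrite Fu Gg => E; move: c1; rewrite -E eqxx.
have := F_morph _ _ _ _ (Ysq c1); rewrite (Ysq c2) !Ff.
have f1 : f 1 = 1 by apply: (mulgI (f 1)); rewrite -fM !mulg1.
by rewrite f1 => /sym2_eq[[_ [->]]|[[<-] [->]]].
Qed.

Theorem theorem14p7 :
  (forall X : topologicalTwoValuedGroupType,
     tv_involutive X -> tv_commutative X -> tv_special X ->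
     hausdorff_space X ->
     exists (V : booleanGroupType) (U : topologicalBooleanGroupType) (s : U),
       [/\ F2_dim_ge V 2, hausdorff_space U, s != 1 &
        tv_isomorphic X (Yspace V s)]) /\
  (forall (V1 V2 : booleanGroupType) (U1 U2 : topologicalBooleanGroupType)
     (s1 : U1) (s2 : U2),
     F2_dim_ge V1 2 -> hausdorff_space U1 -> s1 != 1 ->
     F2_dim_ge V2 2 -> hausdorff_space U2 -> s2 != 1 ->
     (tv_isomorphic (Yspace V1 s1) (Yspace V2 s2) <->
      group_isomorphic V1 V2 /\
      exists f : U1 -> U2, topological_group_iso f /\ f s1 = s2)).
Proof.
split=> [|V1 V2 U1 U2 s1 s2 V1_dim _ s1N _ _ s2N]; first exact: special_isomorphic.
exact: Yspace_isomorphicP.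
Qed.
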